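(* Consider the Euler equations for compressible fluids in a nozzle, $$\partial_t(a\rho)+\partial_x(a\rho u)=0,\quad \partial_t(a\rho u)+\partial_x(a\rho u^2)+a\,\partial_x p=0,\quad \partial_t(a\rho e)+\partial_x\big(au(\rho e+p)\big)=0,\quad \partial_t a=0,$$ written in the nonconservative form $\partial_t U+A(U)\,\partial_x U=0$ in the variable $U=(a\rho,a\rho u,a\rho e,a)$, where $A(U)$ is the explicit $4\times4$ matrix given in the context. Let $g=g(S)$ be any twice differentiable function of the specific entropy $S$ such that (i) $g$ is strictly decreasing as a function of $S$, and (ii) $g(S)$ is strictly convex as a function of $(1/\rho,\varepsilon)$. Then the function $\mathcal U(U)=a\rho\, g(S)$, regarded as a function of the variables $(a\rho,a\rho u,a\rho e,a)$, is convex. Moreover, it satisfies $$D_U\mathcal U(U)\,A(U)=D_U\mathcal F(U),\qquad \mathcal F(U)=a\rho u\,g(S),$$ so that $(\mathcal U,\mathcal F)$ is an entropy pair of the Euler system. Consequently, the entropy inequality in the sense of nonconservative products, $$\partial_t\,\mathcal U(U)+\Big[D_U\mathcal U(U)\,A(U(\cdot,t))\,\partial_xU(\cdot,t)\Big]_\phi\le 0,$$ can be written, independently of the family of paths $\phi$, in the divergence form $$\partial_t\big(a\rho\, g(S)\big)+\partial_x\big(a\rho u\, g(S)\big)\le 0$$ in the sense of distributions.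
   Context: Unknowns: $\rho>0$ is the density, $u$ the velocity, $\varepsilon$ the specific internal energy, $e=\varepsilon+u^2/2$ the total energy, $v=1/\rho$ the specific volume, $p$ the pressure, $T>0$ the temperature, $S$ the specific entropy, $a=a(x)>0$ the cross-section of the nozzle. The thermodynamic variables are related by smooth equations of state $p=p(\rho,\varepsilon)$, $S=S(\rho,\varepsilon)$ satisfying the thermodynamic identity $d\varepsilon=T\,dS-p\,dv$, i.e. $S_\varepsilon=1/T$ and $S_\rho=-p/(T\rho^2)$. Standing assumption (local thermodynamic equilibrium): the map $(v,\varepsilon)\mapsto S$ is strictly concave (equivalently $(v,S)\mapsto\varepsilon$ is strictly convex). The pairs $(v,\varepsilon)$ range over a convex domain. Matrix $A(U)=(a_{ij})$, with $p_\rho,p_\varepsilon$ the partial derivatives of $p(\rho,\varepsilon)$: $a_{11}=0,\ a_{12}=1,\ a_{13}=0,\ a_{14}=0$; $a_{21}=p_\rho-u^2+\frac{p_\varepsilon}{\rho}(u^2-e)$, $a_{22}=2u-\frac{p_\varepsilon u}{\rho}$, $a_{23}=\frac{p_\varepsilon}{\rho}$, $a_{24}=-p_\rho\rho$; $a_{31}=u\Big(p_\rho-e+\frac{p_\varepsilon(u^2-e)-p}{\rho}\Big)$, $a_{32}=e+\frac p\rho-\frac{p_\varepsilon u^2}{\rho}$, $a_{33}=\frac{p_\varepsilon u}{\rho}+u$, $a_{34}=u(p-p_\rho\rho)$; $a_{41}=a_{42}=a_{43}=a_{44}=0$. Entropy pair: a pair of functions $(\mathcal U,\mathcal F)$ of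 $U$ with $\mathcal U$ convex and $D_U\mathcal U\,A=D_U\mathcal F$. Nonconservative product (Dal Maso–LeFloch–Murat): given a Lipschitz family of paths $\phi(s;U_0,U_1)$, $s\in[0,1]$, in the state space with $\phi(0;U_0,U_1)=U_0$, $\phi(1;U_0,U_1)=U_1$, a function $V$ of bounded variation in $x$ and a continuous row-vector-valued function $B$, $[B(V)\,\partial_xV]_\phi$ is the unique measure that equals $B(V)\,\partial_xV$ on Borel subsets of the set of continuity points of $V$, and has mass $\int_0^1B(\phi(s;V_-,V_+))\,\partial_s\phi(s;V_-,V_+)\,ds$ at a jump point of $V$ with left and right limits $V_-,V_+$. *)

(* Defs.v *)
From HB Require Import structures.
From mathcomp Require Import all_boot all_order all_algebra.
From mathcomp Require Import all_classical all_reals all_analysis.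

Set Implicit Arguments.
Unset Strict Implicit.
Unset Printing Implicit Defensive.

Import Order.TTheory GRing.Theory Num.Theory.
Import numFieldNormedType.Exports.

Local Open Scope classical_set_scope.
Local Open Scope ring_scope.

(** * Calculus *)

Section Calculus.
Context {R : realType}.

Definition dir1 : R * R := (1, 0).
Definition dir2 : R * R := (0, 1).

(** [C^oo] on an open set [D] of the plane: all iterated partial derivatives
    exist and are differentiable at every point of [D]. *)
Definition smooth_on (D : set (R * R)) (f : R * R -> R) : Prop :=
  forall (s : seq bool) (z : R * R), D z ->
    differentiable
      (foldr (fun b h => 'D_(if b then dir1 else dir2) h) f s) z.

(** The row vector [D_U f] of the partial derivatives of [f]. *)
Definition grad n (f : 'rV[R]_n -> R) (U : 'rV[R]_n) : 'rV[R]_n :=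
  \row_j 'D_(delta_mx 0 j) f U.

Definition strictly_convex_on (E : lmodType R) (D : set E) (f : E -> R) : Prop :=
  forall x y t, D x -> D y -> x <> y -> 0 < t < 1 ->
    f (t *: x + (1 - t) *: y) < t * f x + (1 - t) * f y.

(** Convexity of a function on a set [O] that need not be convex itself: the
    usual convexity on each convex subset of [O] (in particular along each
    segment contained in [O]).  It is convexity on [O] if [O] is convex. *)
Definition convex_on (E : lmodType R) (O : set E) (f : E -> R) : Prop :=
  forall C : set E, convex_set C -> C `<=` O -> convex_function C f.

End Calculus.

(** * Entropy pairs *)

Section EntropyPair.
Context {R : realType} (n : nat).

Definition entropy_pair (O : set 'rV[R]_n) (A : 'rV[R]_n -> 'M[R]_n)
    (eta q : 'rV[R]_n -> R) : Prop :=
  [/\ convex_on O eta,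
      forall U, O U -> differentiable eta U,
      forall U, O U -> differentiable q U &
      forall U, O U -> grad eta U *m A U = grad q U].

End EntropyPair.

(** * The Dal Maso-LeFloch-Murat nonconservative product *)

Section NonconservativeProduct.
Context {R : realType}.

Notation charge_on_line := (charge (measurableTypeR R) R).
Notation leb := (@lebesgue_measure R).

(** Integral with respect to a finite signed measure, by means of its Jordan
    decomposition; the result does not depend on the chosen Hahn sets. *)
Definition charge_integral (nu : charge_on_line) (E : set R) (f : R -> R) : R :=
  let P := cid (Hahn_decomposition nu) in
  let N := cid (projT2 P) in
  \int[jordan_pos (projT2 N)]_(x in E) f x -
  \int[jordan_neg (projT2 N)]_(x in E) f x.

Definition C1_compact_support (theta : R -> R) : Prop :=
  [/\ forall x, derivable theta x 1,
      continuous (derive1 theta) &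
      compact (closure [set x | theta x != 0])].

(** [nu] is the derivative of [f] in the sense of distributions. *)
Definition distributional_derivative (f : R -> R) (nu : charge_on_line) : Prop :=
  forall theta, C1_compact_support theta ->
    charge_integral nu setT theta = - \int[leb]_x (f x * derive1 theta x).

Section Product.
Variable n : nat.
Implicit Types (O : set 'rV[R]_n) (V : R -> 'rV[R]_n) (B : 'rV[R]_n -> 'rV[R]_n).
Implicit Types (phi : R -> 'rV[R]_n -> 'rV[R]_n -> 'rV[R]_n).

(** Bounded variation on the whole line. *)
Definition BV V : Prop :=
  exists M : R, forall (i : 'I_n) a b, a <= b ->
    (total_variation a b (fun x => V x 0%R i) <= M%:E)%E.

(** BV functions that stay away from the boundary of the state space [O], so
    that one-sided limits are states as well. *)
Definition BV_state O V : Prop :=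
  BV V /\ exists K, [/\ compact K, K `<=` O & forall x, K (V x)].

(** Only the Lipschitz continuity of each path is required, so that the stricter
    conventions on the dependence of the paths upon their end points are covered
    too. *)
Definition lipschitz_paths O phi : Prop :=
  forall U0 U1, O U0 -> O U1 ->
    [/\ phi 0 U0 U1 = U0,
        phi 1 U0 U1 = U1,
        forall s, s \in `[0, 1] -> O (phi s U0 U1) &
        [lipschitz phi s U0 U1 | s in `[0, 1]%classic]].

Definition path_integral B phi (Vl Vr : 'rV[R]_n) : R :=
  \int[leb]_(s in `[0, 1])
    \sum_(i < n) B (phi s Vl Vr) 0 i * (derive1 (fun r => phi r Vl Vr) s) 0 i.

(** [mu] equals [B(V) d_x V] on the Borel sets of continuity points of [V], and
    its mass at any other point is the integral of [B] along the path that joins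
    the one-sided limits of [V] (a loop at a removable discontinuity). *)
Definition is_nonconservative_product B phi V (mu : charge_on_line) : Prop :=
  exists2 nu : 'I_n -> charge_on_line,
    forall i, distributional_derivative (fun x => V x 0 i) (nu i) &
    (forall E : set R, measurable E ->
       E `<=` [set x | {for x, continuous V}] ->
       mu E = (\sum_(i < n) charge_integral (nu i) E (fun x => B (V x) 0 i))%:E)
    /\
    (forall (x : R) Vl Vr, ~ {for x, continuous V} ->
       V y @[y --> x^'-] --> Vl -> V y @[y --> x^'+] --> Vr ->
       mu [set x] = (path_integral B phi Vl Vr)%:E).

(** The measure [[B(V) d_x V]_phi]; a dummy value if there is none. *)
Definition nonconservative_product B phi V : charge_on_line :=
  match pselect (exists mu, is_nonconservative_product B phi V mu) with
  | left ex_mu => projT1 (cid ex_mu)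
  | right _ => czero
  end.

End Product.

(** ** Entropy inequalities in the half-plane [t > 0] *)

Definition half_plane : set (R * R) := [set z | 0 < z.1].

(** Nonnegative test functions [theta (t, x)]. *)
Definition nonneg_test_function (theta : R * R -> R) : Prop :=
  [/\ smooth_on setT theta,
      forall z, 0 <= theta z,
      compact (closure [set z | theta z != 0]) &
      closure [set z | theta z != 0] `<=` half_plane].

Section Inequalities.
Variable n : nat.
Implicit Types (O : set 'rV[R]_n) (U : R -> R -> 'rV[R]_n).
Implicit Types (eta q : 'rV[R]_n -> R) (A : 'rV[R]_n -> 'M[R]_n).
Implicit Types (phi : R -> 'rV[R]_n -> 'rV[R]_n -> 'rV[R]_n).

(** Fields [U t x] that are BV in [x] and, locally uniformly in time, stay away
    from the boundary of the state space. *)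
Definition BV_field O U : Prop :=
  [/\ forall i : 'I_n, measurable_fun half_plane (fun z : R * R => U z.1 z.2 0 i),
      forall t, 0 < t -> BV (U t) &
      forall t1 t2, 0 < t1 -> exists K, [/\ compact K, K `<=` O &
        forall t x, t \in `[t1, t2] -> K (U t x)]].

(** [d_t eta(U) + [D_U eta(U) A(U) d_x U]_phi <= 0] *)
Definition nonconservative_entropy_inequality A eta phi U : Prop :=
  forall theta, nonneg_test_function theta ->
    - (\int[(leb \x leb)%E]_(z in half_plane)
         (eta (U z.1 z.2) * 'D_dir1 theta z)) +
    \int[leb]_(t in `]0, +oo[)
       charge_integral
         (nonconservative_product (fun W => grad eta W *m A W) phi (U t))
         setT (fun x => theta (t, x))
    <= 0.

(** [d_t eta(U) + d_x q(U) <= 0] *)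
Definition divergence_entropy_inequality eta q U : Prop :=
  forall theta, nonneg_test_function theta ->
    - (\int[(leb \x leb)%E]_(z in half_plane)
         (eta (U z.1 z.2) * 'D_dir1 theta z + q (U z.1 z.2) * 'D_dir2 theta z))
    <= 0.

End Inequalities.

End NonconservativeProduct.

(** * The Euler equations in a nozzle *)

Section Nozzle.
Context {R : realType}.

(** The thermodynamic domain [D] is a set of pairs (specific volume, internal
    energy), while the equations of state are functions of (density, internal
    energy). *)
Definition density_domain (D : set (R * R)) : set (R * R) :=
  [set z | 0 < z.1 /\ D (z.1^-1, z.2)].

Definition of_volume (f : R * R -> R) : R * R -> R :=
  fun w => f (w.1^-1, w.2).

Record equations_of_state (D : set (R * R)) (p S T : R * R -> R) : Prop := {
  eos_open : open D;
  eos_convex : convex_set D;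
  eos_volume_gt0 : forall w, D w -> 0 < w.1;
  eos_smooth_p : smooth_on (density_domain D) p;
  eos_smooth_S : smooth_on (density_domain D) S;
  eos_T_gt0 : forall z, density_domain D z -> 0 < T z;
  eos_S_eps : forall z, density_domain D z -> 'D_dir2 S z = (T z)^-1;
  eos_S_rho : forall z, density_domain D z ->
    'D_dir1 S z = - p z / (T z * z.1 ^+ 2);
  eos_concave : strictly_convex_on D (fun w => - of_volume S w) }.

Implicit Type U : 'rV[R]_4.

(** [U = (a rho, a rho u, a rho e, a)] *)
Definition area U : R := U 0 3%:R.
Definition density U : R := U 0 0 / area U.
Definition velocity U : R := U 0 1%:R / U 0 0.
Definition total_energy U : R := U 0 2%:R / U 0 0.
Definition internal_energy U : R := total_energy U - velocity U ^+ 2 / 2%:R.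

Definition thermo U : R * R := (density U, internal_energy U).

Definition nozzle_states (D : set (R * R)) : set 'rV[R]_4 :=
  [set U | 0 < area U /\ density_domain D (thermo U)].

Definition nozzle_matrix (p : R * R -> R) U : 'M[R]_4 :=
  let rho := density U in
  let u := velocity U in
  let e := total_energy U in
  let P := p (thermo U) in
  let p_rho := 'D_dir1 p (thermo U) in
  let p_eps := 'D_dir2 p (thermo U) in
  \matrix_(i, j) nth 0 (nth [::] [::
    [:: 0; 1; 0; 0];
    [:: p_rho - u ^+ 2 + p_eps / rho * (u ^+ 2 - e);
        2%:R * u - p_eps * u / rho;
        p_eps / rho;
        - (p_rho * rho)];
    [:: u * (p_rho - e + (p_eps * (u ^+ 2 - e) - P) / rho);
        e + P / rho - p_eps * u ^+ 2 / rho;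
        p_eps * u / rho + u;
        u * (P - p_rho * rho)];
    [:: 0; 0; 0; 0]] i) j.

Definition nozzle_entropy (S : R * R -> R) (g : R -> R) U : R :=
  area U * density U * g (S (thermo U)).

Definition nozzle_entropy_flux (S : R * R -> R) (g : R -> R) U : R :=
  area U * density U * velocity U * g (S (thermo U)).

End Nozzle.

(* Main.v *)
(* Convexity: [a rho g(S)] is the perspective [U0 h(U3 / U0, U2 / U0 - (U1 / U0)^2 / 2)]
   of [h(v, eps) = g(S)], which is convex by hypothesis and decreasing in [eps]
   because [S_eps = 1 / T > 0].  The compatibility relation is a computation with
   the thermodynamic identities.

   Independence of the paths: [B = D_U eta A] is the gradient of a [C^1] function
   [q], so that the integral of [B] along a Lipschitz path from [Vl] to [Vr] is
   [q Vr - q Vl].  If [V] is BV and [W] is its total variation function, then [V]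
   and [q o V] are Lipschitz functions of [W]; their derivatives are push-forwards
   of densities, for which the chain rule on the continuity set of [V] is the
   classical one.  Hence the nonconservative product is the distributional
   derivative of [q o V].  Testing it against a smooth function in [x] and
   integrating in [t] turns one entropy inequality into the other. *)

Require Import Defs.
From HB Require Import structures.
From mathcomp Require Import all_boot all_order all_algebra.
From mathcomp Require Import all_classical all_reals all_analysis.
From mathcomp Require Import measurable_realfun ring lra.

Import Order.TTheory GRing.Theory Num.Theory.
Import numFieldNormedType.Exports.

Local Open Scope classical_set_scope.
Local Open Scope ring_scope.

(** * Lipschitz functions and functions of bounded variation *)

(** [nonconservative_product] is a measure picked by choice, with a dummy value if there is none, so
    existence and uniqueness must both be known before the two inequalities can be compared.
    Existence is the chain rule for [q o V]. Uniqueness rests on bump functions, which determine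
    each [nu i], and on the countability of the discontinuity set, where only point masses remain to
    be matched. The obstacle is the chain rule. Lipschitz functions given on the range of [W] are
    extended to the line, but in the gaps left by the jumps the extension of [q o V] need not be [q]
    composed with the extension of [V]. They agree on the range, and over the continuity set of [V]
    each relevant [s] is a value of [W] approached from above by other values, which is enough to
    compare derivatives. Almost everywhere differentiability of Lipschitz functions serves twice: in
    the parameter [W] and along the paths. Two derivatives of [g] make its first derivative
    continuous on the entropy values; this is what makes the flux [C^1]. *)

Section LipschitzFTC.

Lemma cst_integrable d (T : measurableType d) (R : realType)
    (mu : {measure set T -> \bar R}) (A : set T) (k : R) :
  measurable A -> (mu A < +oo)%E -> mu.-integrable A (EFin \o cst k).
Proof.
move=> mA Aoo; apply: measurable_bounded_integrable => //.
by exists `|k|; split; [exact: num_real|move=> M kM x _ /=; exact: ltW].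
Qed.

Context {R : realType}.
Notation leb := (@lebesgue_measure R).

Lemma lipschitz_continuous (L : R) (F : R -> R) :
  (forall x y, `|F x - F y| <= L * `|x - y|) -> continuous F.
Proof.
move=> FL x; apply/cvgrPdist_lt => e e0.
have M0 : 0 < `|L| + 1 by rewrite ltr_wpDl.
have eM : 0 < e / (`|L| + 1) by rewrite divr_gt0.
near=> y.
have xy : `|x - y| < e / (`|L| + 1).
  by near: y; apply: cvgr_dist_lt => //; exact: cvg_id.
apply: (le_lt_trans (FL x y)).
apply: (@le_lt_trans _ _ ((`|L| + 1) * `|x - y|)).
  by rewrite ler_wpM2r// (le_trans (ler_norm L))// lerDl.
by rewrite mulrC -ltr_pdivlMr.
Unshelve. all: by end_near. Qed.

(* The measures of [(x + F x) / 2] and [(x - F x) / 2] add up to the Lebesgue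
   measure, so both are absolutely continuous. *)
Lemma lipschitz1_lebesgue_stieltjes (F : R -> R) :
  (forall x y, `|F x - F y| <= `|x - y|) ->
  exists2 m : {measure set (measurableTypeR R) -> \bar R},
    forall a b, a <= b -> m `]a, b]%classic = ((F b - F a + (b - a)) / 2)%:E &
    m `<< leb.
Proof.
move=> F1.
have cF : continuous F.
  by apply: (@lipschitz_continuous 1) => x y; rewrite mul1r.
have F1' x y : x <= y -> `|F y - F x| <= y - x.
  by move=> xy; rewrite (le_trans (F1 _ _))// ger0_norm// subr_ge0.
have cum (g : R -> R) : continuous g ->
    (forall x y, x <= y -> `|g y - g x| <= y - x) ->
    {f : cumulative R R | (f : R -> R) = (fun x => (x + g x) / 2)}.
  move=> cg g1; pose f x := (x + g x) / 2.
  have ndf : nondecreasing f.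
    move=> x y xy; rewrite /f ler_pM2r//.
    by have := g1 _ _ xy; rewrite ler_norml => /andP[]; lra.
  have rcf : right_continuous f.
    apply: right_continuousW => x; apply: cvgMl.
    by apply: cvgD; [exact: cvg_id|exact: cg].
  pose fc := isCumulative.Build R _ R f ndf rcf.
  pose fs : cumulative R R := HB.pack f fc.
  by exists fs.
have [f1 f1E] := cum F cF F1'.
have cFN : continuous (\- F) by move=> x; apply: cvgN; exact: cF.
have FN1 x y : x <= y -> `|(\- F) y - (\- F) x| <= y - x.
  by move=> xy /=; rewrite -opprB opprK addrC normrN; exact: F1'.
have [f2 f2E] := cum (\- F) cFN FN1.
pose m1 := lebesgue_stieltjes_measure f1.
pose m2 := lebesgue_stieltjes_measure f2.
have lsE (f : cumulative R R) a b : a <= b ->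
    lebesgue_stieltjes_measure f `]a, b]%classic = (f b - f a)%:E.
  move=> ab; rewrite /lebesgue_stieltjes_measure/= /measure_extension/=.
  rewrite measurable_mu_extE/=; last exact: is_ocitv.
  by rewrite wlength_itv_bnd.
exists m1.
  move=> a b ab; rewrite [LHS](lsE f1 a b ab) f1E; congr (_%:E); lra.
have sumE A : measurable A -> leb A = (measure_add m1 m2) A.
  move=> mA; apply: lebesgue_measure_unique => // _ [[a b] _ <-].
  rewrite [RHS](measure_addE m1 m2) /=.
  have [ab|ba] := leP a b; last first.
    by rewrite set_itv_ge ?measure0 ?adde0// bnd_simp -leNgt ltW.
  rewrite lebesgue_measure_itv/= lte_fin.
  rewrite [X in (_ = X + _)%E](lsE f1 a b ab) [X in (_ = _ + X)%E](lsE f2 a b ab).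
  rewrite f1E f2E.
  case: ltP ab => [ab _|ba ab].
    by rewrite EFinN -EFinB -EFinD; congr (_%:E); rewrite /=; lra.
  have -> : a = b by apply/le_anti; rewrite ab ba.
  by rewrite !subrr adde0.
apply/null_content_dominatesP => A mA lA0.
have := sumE A mA; rewrite (measure_addE m1 m2) [X in X = _ -> _]lA0 => /esym/eqP.
by rewrite padde_eq0 ?measure_ge0// => /andP[/eqP].
Qed.

Lemma lebesgue_measure_oc (x y : R) : x <= y ->
  leb `]x, y]%classic = (y - x)%:E.
Proof.
move=> xy; rewrite lebesgue_measure_itv/= lte_fin.
case: ltP xy => // yx xy; have -> : x = y by apply/le_anti; rewrite xy yx.
by rewrite subrr.
Qed.

(** Rademacher's theorem on the line. The measure of [(x + L^-1 * F x) / 2] is absolutely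
    continuous; on []a, b]] its Radon-Nikodym density [k] has that function as a primitive up to a
    constant, and [FTC1] differentiates the primitive almost everywhere. *)
Lemma lipschitz_FTC (L : R) (F : R -> R) (a b : R) : 0 < L ->
  (forall x y, `|F x - F y| <= L * `|x - y|) ->
  exists h : R -> R, [/\ measurable_fun setT h,
    leb.-integrable `]a, b]%classic (EFin \o h),
    forall x y, a <= x -> x <= y -> y <= b ->
      (\int[leb]_(s in `]x, y]) h s = F y - F x)%R &
    {ae leb, forall x : R, a < x -> x < b -> is_derive x 1 F (h x)}].
Proof.
move=> L0 FL.
have F1 x y : `|L^-1 * F x - L^-1 * F y| <= `|x - y|.
  by rewrite -mulrBr normrM gtr0_norm ?invr_gt0// ler_pdivrMl.
have [m mE mleb] := @lipschitz1_lebesgue_stieltjes (fun x => L^-1 * F x) F1.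
(* For [b < a] the interval is empty and the zero function serves. *)
have [ab|ba] := leP a b; last first.
  exists (cst 0); split => //.
  - by rewrite set_itv_ge ?bnd_simp -?leNgt ?(ltW ba)//; exact: integrable_set0.
  - by move=> x y ax xy yb; have := le_lt_trans (le_trans ax (le_trans xy yb)) ba;
      rewrite ltxx.
  - by apply: aeW => x /= ax /(lt_trans ax) /(lt_trans ba); rewrite ltxx.
have mD : measurable (`]a, b]%classic : set (measurableTypeR R)) by exact: measurable_itv.
have mDoo : (m `]a, b]%classic < +oo)%E by rewrite mE// ltry.
(* Restricting to []a, b]] makes the measure finite, hence its density integrable. *)
pose nu : {finite_measure set (measurableTypeR R) -> \bar R} := mfrestr mD mDoo.
have nuleb : nu `<< leb.
  apply/null_content_dominatesP => A mA lA0.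
  have dom := (null_content_dominatesP _ _).1 mleb.
  have mAD : measurable (A `&` `]a, b]%classic) by exact: measurableI.
  apply: (dom _ mAD).
  by apply: (subset_measure0 mAD mA) => // x [].
pose r : R -> \bar R := Radon_Nikodym_SigmaFinite.f nu leb.
have r_fin x : r x \is a fin_num by exact: Radon_Nikodym_SigmaFinite.f_fin_num.
have r_int : leb.-integrable setT r by exact: Radon_Nikodym_SigmaFinite.f_integrable.
pose k := fine \o r.
have rE : r = EFin \o k by apply/funext => x /=; rewrite fineK.
have k_int : leb.-integrable setT (EFin \o k) by rewrite -rE.
have mk : measurable_fun setT k by apply/measurable_EFinP; apply: measurable_int k_int.
have kE x y : a <= x -> x <= y -> y <= b ->
    (\int[leb]_(s in `]x, y]) k s)%R = (L^-1 * F y - L^-1 * F x + (y - x)) / 2.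
  move=> ax xy yb.
  transitivity (fine (\int[leb]_(s in `]x, y]%classic) r s)); first by rewrite rE.
  rewrite -Radon_Nikodym_SigmaFinite.f_integral//.
  rewrite /nu/= /mfrestr/= /mrestr/= setIidl.
    by rewrite mE.
  by move=> z /=; rewrite !in_itv/= => /andP[xz zy]; rewrite (le_lt_trans ax xz) (le_trans zy yb).
pose G x := (\int[leb]_(s in `]a, x]) k s)%R.
have k_loc : locally_integrable setT k by apply: open_integrable_locally => //; exact: openT.
have dG : {ae leb, forall x : R, a < x -> is_derive x 1 G (k x)}.
  have : {ae leb, forall x : R, (BRight a < BRight x)%O -> derivable G x 1 /\ derive1 G x = k x}.
    have k_inty (y : R) : leb.-integrable [set` Interval (BRight a) (BRight y)] (EFin \o k).
      exact: integrableS k_int.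
    exact: (FTC1 k_inty k_loc).
  apply: filterS; first exact: (ae_filter_ringOfSetsType leb).
  move=> x dGx ax; have [G1 G2] := dGx ax.
  by split; [exact: G1|rewrite -derive1E; exact: G2].
(* This solves [k = (L^-1 * F' + 1) / 2] for the derivative [F']. *)
exists (fun s => L * (2 * k s - 1)); split.
- apply: measurable_funM => //; apply: measurable_funB => //.
  exact: measurable_funM.
- have -> : EFin \o (fun s => L * (2 * k s - 1)) = (fun s => L%:E * (2%:E * (k s)%:E - 1%:E))%E.
    by apply/funext => s /=; rewrite EFinM EFinB EFinM.
  apply: integrableZl => //; apply: integrableB => //.
    by apply: integrableZl => //; exact: integrableS k_int.
  apply: cst_integrable; first exact: measurable_itv.
  by rewrite [ltLHS](lebesgue_measure_oc _ _ ab) ltry.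
- move=> x y ax xy yb.
  have k_int' : leb.-integrable `]x, y]%classic (EFin \o k) by exact: integrableS k_int.
  have c_int c : leb.-integrable `]x, y]%classic (EFin \o cst c).
    apply: cst_integrable; first exact: measurable_itv.
    by rewrite [ltLHS](lebesgue_measure_oc _ _ xy) ltry.
  have k2_int : leb.-integrable `]x, y]%classic (EFin \o (fun s => 2 * k s)).
    have -> : EFin \o (fun s => 2 * k s) = (fun s => 2%:E * (k s)%:E)%E.
      by apply/funext => s /=; rewrite EFinM.
    exact: integrableZl.
  rewrite RintegralZl//; last by have := integrableB _ k2_int (c_int 1); apply.
  rewrite RintegralB//; last exact: (c_int 1).
  rewrite RintegralZl// kE// Rintegral_cst//.
  rewrite [X in fine X](lebesgue_measure_oc _ _ xy)/=.
  field; exact: lt0r_neq0.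
- move: dG; apply: filterS; first exact: (ae_filter_ringOfSetsType leb).
  move=> x dGx ax xb.
  have {}dGx := dGx ax.
  have FE : \near x, F x = F a + L * (2 * G x - (x - a)).
    near=> y; rewrite /G kE//; last 2 first.
    + by apply: ltW; near: y; exact: lt_nbhsr.
    + by apply: ltW; near: y; exact: lt_nbhsl.
    by field; exact: lt0r_neq0.
  apply: (@near_eq_is_derive _ _ _ (fun x => F a + L * (2 * G x - (x - a)))).
    by near do apply/esym.
  apply: is_derive_eq.
  rewrite /GRing.scale/=; ring.
Unshelve. all: by end_near. Qed.

End LipschitzFTC.

(** * Variation functions as parameters of BV functions, and their generalized inverses *)

Section BoundedVariation.
Context {R : realType}.

(** [W] is the variation measured from 0, with a minus sign to the left of 0: it involves variations
    over bounded intervals alone, so the bound [M] passes to [W]. *)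
Lemma total_variation_primitive (f : R -> R) (M : R) :
  (forall a b, a <= b -> (total_variation a b f <= M%:E)%E) ->
  exists W : R -> R, [/\ {homo W : x y / x <= y},
    forall x, `|W x| <= M,
    forall x y, x <= y -> `|f y - f x| <= W y - W x &
    forall x, {for x, continuous f} -> {for x, continuous W}].
Proof.
move=> fM.
have TVfin a b : a <= b -> total_variation a b f \is a fin_num.
  move=> ab; rewrite ge0_fin_numE ?total_variation_ge0//.
  exact: (le_lt_trans (fM _ _ ab) (ltry _)).
have bvf a b : a <= b -> bounded_variation a b f.
  by move=> ab; apply/bounded_variationP => //; exact: TVfin.
pose v a b := fine (total_variation a b f).
have v_ge a b : a <= b -> `|f b - f a| <= v a b.
  by move=> ab; rewrite -lee_fin fineK ?TVfin//; exact: total_variation_ge.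
have v_ge0 a b : a <= b -> 0 <= v a b.
  by move=> ab; rewrite fine_ge0// total_variation_ge0.
have v_le a b : a <= b -> v a b <= M.
  by move=> ab; rewrite -lee_fin fineK ?TVfin//; exact: fM.
have vD a b c : a <= c -> c <= b -> v a b = v a c + v c b.
  move=> ac cb; rewrite /v (total_variationD _ ac cb) fineD//; exact: TVfin.
pose W x := if 0 <= x then v 0 x else - v x 0.
have WD x y : x <= y -> W y - W x = v x y.
  move=> xy; rewrite /W; case: (leP 0 y) => y0; case: (leP 0 x) => x0.
  - by rewrite (vD 0 y x)//; ring.
  - by rewrite (vD x y 0)//; [ring|exact: ltW].
  - by have := lt_le_trans y0 (le_trans x0 xy); rewrite ltxx.
  - by rewrite (vD x 0 y)//; [ring|exact: ltW].
exists W; split.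
- by move=> x y xy; rewrite -subr_ge0 WD// v_ge0.
- move=> x; rewrite /W; case: (leP 0 x) => [x0|/ltW x0]; rewrite ?normrN.
    by rewrite (ger0_norm (v_ge0 _ _ x0)) v_le.
  by rewrite (ger0_norm (v_ge0 _ _ x0)) v_le.
- by move=> x y xy; rewrite WD// v_ge.
- move=> x /left_right_continuousP[fl fr].
  (* One-sided continuity of the variation is applied on [[x - 1, x + 1]], where [W] is the
     variation from [x - 1] plus a constant. *)
  have x1x : x - 1 < x by rewrite gtrBl.
  have xx1 : x < x + 1 by rewrite ltrDl.
  have bvx := bvf _ _ (ltW (lt_trans x1x xx1)).
  have WE y : x - 1 <= y -> W y = v (x - 1) y + W (x - 1).
    by move=> /WD <-; rewrite subrK.
  apply/left_right_continuousP; split.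
  + have /(cvgD (g := cst (W (x - 1)))) := total_variation_left_continuous x1x (ltW xx1) fl bvx.
    move=> /(_ _ (cvg_cst _)); rewrite -[X in _ --> X -> _]/(v (x - 1) x + W (x - 1)) -WE ?(ltW x1x)//.
    apply: cvg_trans; apply: near_eq_cvg; near=> y.
    rewrite -[LHS]/(v (x - 1) y + W (x - 1)) -WE//; near: y; exact: nbhs_left_ge.
  + have /(cvgD (g := cst (W (x - 1)))) := total_variation_right_continuous (ltW x1x) xx1 fr bvx.
    move=> /(_ _ (cvg_cst _)); rewrite -[X in _ --> X -> _]/(v (x - 1) x + W (x - 1)) -WE ?(ltW x1x)//.
    apply: cvg_trans; apply: near_eq_cvg; near=> y.
    rewrite -[LHS]/(v (x - 1) y + W (x - 1)) -WE//; apply: (le_trans (ltW x1x)); near: y; exact: nbhs_right_ge.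
Unshelve. all: by end_near. Qed.

(** The sum of the variation functions of the coordinates is one parameter in which all coordinates
    are 1-Lipschitz, and it is discontinuous only where [V] is. *)
Lemma BV_parametrization n (V : R -> 'rV[R]_n) : BV V ->
  exists M (W : R -> R), [/\ {homo W : x y / x <= y},
    forall x, `|W x| <= M,
    forall i x y, x <= y -> `|V y 0 i - V x 0 i| <= W y - W x &
    forall x, {for x, continuous V} -> {for x, continuous W}].
Proof.
move=> [M VM].
have /choice[w wP] i := @total_variation_primitive (fun x => V x 0 i) M (VM i).
exists (\sum_(i < n) M), (fun x => \sum_i w i x); split.
- by move=> x y xy; apply: ler_sum => i _; have [+ _ _ _] := wP i; apply.
- move=> x; apply: (le_trans (ler_norm_sum _ _ _)).
  by apply: ler_sum => i _; have [_ + _ _] := wP i; apply.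
- move=> i x y xy; rewrite -sumrB (bigD1 i)//=.
  have [_ _ wi _] := wP i; rewrite (le_trans (wi _ _ xy))// lerDl.
  by apply: sumr_ge0 => j _; rewrite subr_ge0; have [+ _ _ _] := wP j; apply.
- move=> x cV; apply: cvg_big => [|i _]; first exact: add_continuous.
  have [_ _ _] := wP i; apply.
  exact: (cvg_comp _ _ cV (@coord_continuous _ _ _ _ _ _)).
Qed.

(* McShane's extension [s |-> inf_x (f x + L |s - W x|)]. *)
Lemma lipschitz_extension (W f : R -> R) (L : R) : 0 <= L ->
  (forall x y, `|f x - f y| <= L * `|W x - W y|) ->
  exists2 F : R -> R, forall s t, `|F s - F t| <= L * `|s - t| &
    forall x, F (W x) = f x.
Proof.
move=> L0 fW.
pose E s := [set f x + L * `|s - W x| | x in [set: R]].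
have E0 s : E s !=set0 by exists (f 0 + L * `|s - W 0|); exists 0.
have Elb s x : f x - L * `|s - W x| <= inf (E s).
  apply: lb_le_inf => // _ [y _ <-].
  have := fW x y; rewrite ler_norml => /andP[_].
  have : `|W x - W y| <= `|s - W x| + `|s - W y|.
    by rewrite (_ : W x - W y = (s - W y) - (s - W x)); [rewrite [leRHS]addrC ler_normB|ring].
  by move=> /(ler_wpM2l L0); rewrite mulrDr; lra.
have Eub s x : inf (E s) <= f x + L * `|s - W x|.
  apply: ge_inf; last by exists x.
  exists (f 0 - L * `|s - W 0|) => _ [y _ <-].
  have := fW 0 y; rewrite ler_norml => /andP[_].
  have : `|W 0 - W y| <= `|s - W 0| + `|s - W y|.
    by rewrite (_ : W 0 - W y = (s - W y) - (s - W 0)); [rewrite [leRHS]addrC ler_normB|ring].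
  by move=> /(ler_wpM2l L0); rewrite mulrDr; lra.
have half s t : inf (E s) <= inf (E t) + L * `|s - t|.
  rewrite -lerBlDr; apply: lb_le_inf => // _ [y _ <-].
  rewrite lerBlDr (le_trans (Eub s y))// -addrA lerD2l -mulrDr ler_wpM2l//.
  by rewrite (_ : s - W y = (t - W y) + (s - t)); [rewrite ler_normD|ring].
exists (fun s => inf (E s)) => [s t|x].
  rewrite ler_norml; have := half s t; have := half t s.
  by rewrite (distrC t s); lra.
apply/le_anti; have := Eub (W x) x; have := Elb (W x) x.
by rewrite subrr normr0 mulr0; lra.
Qed.

(* [T] is the generalized inverse [s |-> inf {x | s < W x}] on [`]w0, w1[]; elsewhere
   this [inf] would be that of an empty or an unbounded set, and [T] is set to [0]. *)
Lemma time_change (W : R -> R) (M : R) :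
  {homo W : x y / x <= y} -> (forall x, `|W x| <= M) ->
  exists w0 w1 (T : R -> R), [/\ measurable_fun setT T,
    forall x, w0 <= W x <= w1,
    forall s x, w0 < s -> s < w1 -> T s < x -> s < W x &
    forall s x, w0 < s -> s < w1 -> s < W x -> T s <= x].
Proof.
move=> ndW WM.
have W0 : range W !=set0 by exists (W 0), 0.
have ubW : has_ubound (range W).
  by exists M => _ [x _ <-]; rewrite (le_trans (ler_norm _)).
have lbW : has_lbound (range W).
  by exists (- M) => _ [x _ <-]; have := WM x; rewrite ler_norml => /andP[].
pose w0 := inf (range W); pose w1 := sup (range W).
pose E s := [set x | s < W x].
pose T s := inf (E s).
have E0 s : s < w1 -> E s !=set0.
  by move=> /(sup_gt W0)[_ [x _ <-] sx]; exists x.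
have lbE s : w0 < s -> has_lbound (E s).
  move=> /(inf_lt W0)[_ [x _ <-] xs]; exists x => y /= sy.
  by rewrite leNgt; apply/negP => /ltW /ndW /(lt_le_trans sy) /(lt_trans xs); rewrite ltxx.
have T_lt s x : w0 < s -> s < w1 -> T s < x -> s < W x.
  move=> s0 s1 /(inf_lt (E0 _ s1))[y sy yx].
  by rewrite (lt_le_trans sy)// ndW// ltW.
have T_le s x : w0 < s -> s < w1 -> s < W x -> T s <= x.
  by move=> s0 s1 sx; apply: ge_inf => //; exact: lbE.
exists w0, w1, (T \_ `]w0, w1[); split.
- apply/(measurable_restrictT _ _).1; first exact: measurable_itv.
  apply: (measurability (@RGenCInfty.G R)) => [|/= _ [_] [r] -> <-].
    exact: RGenCInfty.measurableE.
  (* [T] is nondecreasing on []w0, w1[], so the preimage of a half-line meets this interval in an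
     interval. *)
  apply: is_interval_measurable => s t /= [+ sr] [+ tr] z /andP[sz zt].
  rewrite !in_itv/= !andbT => /andP[s0 s1] /andP[t0 t1].
  have z0 : w0 < z by exact: lt_le_trans sz.
  have z1 : z < w1 by exact: le_lt_trans t1.
  split; first by rewrite z0.
  move: sr; rewrite /= !in_itv/= !andbT => sr; rewrite (le_trans sr)//.
  apply: lb_le_inf; first exact: E0.
  by move=> x /= zx; apply: T_le => //; exact: le_lt_trans zx.
- by move=> x; rewrite ge_inf ?ub_le_sup//; exists x.
- move=> s x s0 s1; rewrite patchE.
  have -> : s \in (`]w0, w1[%classic : set R) by rewrite inE/= in_itv/= s0.
  exact: T_lt.
- move=> s x s0 s1; rewrite patchE.
  have -> : s \in (`]w0, w1[%classic : set R) by rewrite inE/= in_itv/= s0.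
  exact: T_le.
Qed.

End BoundedVariation.

(** * Charges on the line and distributional derivatives *)

Section DensityCharge.
Context {R : realType}.
Notation leb := (@lebesgue_measure R).
Notation charge_on_line := (charge (measurableTypeR R) R).

(** The change of variables holds for the Radon-Nikodym derivative of [nu], which equals [k] almost
    everywhere because both have the same integral over every measurable set. *)
Lemma density_measure d (T : measurableType d)
    (mu : {sigma_finite_measure set T -> \bar R}) (k : T -> R) :
  mu.-integrable setT (EFin \o k) -> (forall x, 0 <= k x) ->
  exists2 nu : {finite_measure set T -> \bar R},
    forall A, measurable A -> nu A = (\int[mu]_(x in A) (k x)%:E)%E &
    forall (f : T -> \bar R) A, measurable A -> nu.-integrable A f ->
      (\int[nu]_(x in A) f x = \int[mu]_(x in A) (f x * (k x)%:E))%E.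
Proof.
move=> ik k0.
pose nu0 (A : set T) := (\int[mu]_(x in A) (k x)%:E)%E.
have nu0_0 : nu0 set0 = 0%E by rewrite /nu0 integral_set0.
have nu0_ge0 A : (0 <= nu0 A)%E by apply: integral_ge0 => x _; rewrite lee_fin.
have nu0_add : semi_sigma_additive nu0.
  apply: semi_sigma_additive_nng_induced => [|x]; first exact: measurable_int ik.
  by rewrite lee_fin.
pose isM := isMeasure.Build d T R nu0 nu0_0 nu0_ge0 nu0_add.
pose nu1 : {measure set T -> \bar R} := HB.pack nu0 isM.
have nu1_fin : fin_num_fun nu1.
  by move=> A mA; apply: integrable_fin_num => //; exact: integrableS ik.
pose isF := Measure_isFinite.Build d T R nu1 nu1_fin.
pose nu : {finite_measure set T -> \bar R} := HB.pack nu0 isM isF.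
exists nu => // f A mA nuf.
have dom : nu `<< mu.
  apply/null_content_dominatesP => B mB muB0.
  by apply: null_set_integral => //; apply: measurable_funTS; exact: measurable_int ik.
rewrite -(Radon_Nikodym_change_of_variables dom)//.
have mf : measurable_fun A f by exact: measurable_int nuf.
apply: ae_eq_integral => //.
- apply: emeasurable_funM => //; apply: measurable_funTS.
  by apply: (@measurable_int _ _ _ mu); exact: Radon_Nikodym_integrable.
- by apply: emeasurable_funM => //; apply: measurable_funTS; exact: measurable_int ik.
- apply: ae_eqe_mul2l; apply: (@ae_eq_trans _ _ _ mu _ _ _ (Radon_Nikodym_SigmaFinite.f nu mu)).
    by apply: ae_eq_sym; exact: ae_eq_Radon_Nikodym_SigmaFinite.
  apply: integral_ae_eq => //.
  + by apply: (integrableS measurableT) => //; exact: Radon_Nikodym_SigmaFinite.f_integrable.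
  + by apply: measurable_funTS; exact: measurable_int ik.
  + by move=> B BA mB; rewrite -Radon_Nikodym_SigmaFinite.f_integral.
Qed.

Lemma pushforward_finite_measure d1 d2 (X : measurableType d1) (Y : measurableType d2)
    (phi : X -> Y) (nu : {finite_measure set X -> \bar R}) :
  measurable_fun setT phi ->
  exists2 m : {finite_measure set Y -> \bar R},
    forall A, m A = nu (phi @^-1` A) &
    forall (f : Y -> \bar R) D, measurable D -> measurable_fun setT f ->
      nu.-integrable (phi @^-1` D) (f \o phi) ->
      (\int[m]_(y in D) f y = \int[nu]_(x in phi @^-1` D) (f \o phi) x)%E.
Proof.
move=> mphi; have mphi1 := mphi.
pose pm : {measure set Y -> \bar R} := pushforward nu phi.
pose m0 := pm mphi.
have m0fin : fin_num_fun m0.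
  move=> A mA; apply: fin_num_measure.
  by rewrite -[X in measurable X]setTI; exact: mphi1.
pose isF := Measure_isFinite.Build _ Y R m0 m0fin.
pose m : {finite_measure set Y -> \bar R} :=
  HB.pack (m0 : set Y -> \bar R) (Measure.class m0) isF.
by exists m => // f D mD mf nuf; exact: (integral_pushforward mphi1 mf nuf mD).
Qed.

(** Makes the arbitrary Hahn sets in [charge_integral] harmless: two decompositions [a - b] and
    [mp - mn] of the same charge give the equality of measures [a + mn = b + mp], which can be
    integrated term by term. *)
Lemma charge_integralE (nu : charge_on_line) (mp mn : {finite_measure set (measurableTypeR R) -> \bar R})
    (f : R -> R) (E : set (measurableTypeR R)) :
  (forall A, measurable A -> nu A = mp A - mn A)%E ->
  measurable_fun setT f -> (exists C, forall x, `|f x| <= C) -> measurable E ->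
  charge_integral nu E f = \int[mp]_(x in E) f x - \int[mn]_(x in E) f x.
Proof.
move=> nuE mf [C fC] mE; rewrite /charge_integral.
case: cid => P /= exN; case: cid => N /= PN.
set a := jordan_pos PN; set b := jordan_neg PN.
have finm (m : {finite_measure set (measurableTypeR R) -> \bar R}) A :
  measurable A -> m A \is a fin_num by move=> mA; exact: fin_num_measure.
have abE A : measurable A -> (measure_add a mn A = measure_add b mp A)%E.
  move=> mA; rewrite (measure_addE a mn) (measure_addE b mp).
  have : (mp A - mn A = a A - b A)%E.
    rewrite -nuE// (jordan_decomp PN mA) /cadd/= cscaleN1/=.
    by [].
  have key (x y z w : \bar R) : x \is a fin_num -> y \is a fin_num ->
      z \is a fin_num -> w \is a fin_num -> (x - y = z - w -> z + y = w + x)%E.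
    case: x y z w => [x| |] // [y| |] // [z| |] // [w| |] // _ _ _ _.
    by rewrite -!EFinB -!EFinD => -[] ?; congr (_%:E); lra.
  by apply: key; exact: finm.
have fint (m : {finite_measure set (measurableTypeR R) -> \bar R}) :
    m.-integrable E (EFin \o f).
  apply: measurable_bounded_integrable => //.
  - by rewrite -ge0_fin_numE ?finm.
  - exact: measurable_funTS.
  - exists C; split; first exact: num_real.
    by move=> M CM x _ /=; rewrite (le_trans (fC x))// ltW.
have := eq_measure_integral (measure_add b mp) (fun A mA _ => abE A mA) (D := E) (f := EFin \o f).
rewrite (integral_measure_add mE (fint b) (fint mp)). 
rewrite (integral_measure_add mE (fint a) (fint mn)). 
have finI (m : {finite_measure set (measurableTypeR R) -> \bar R}) :
    (\int[m]_(x in E) (EFin \o f) x = (\int[m]_(x in E) f x)%:E)%E.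
  by rewrite /Rintegral fineK//; apply: integrable_fin_num => //; exact: fint.
rewrite !finI -!EFinD => -[] ?; lra.
Qed.

(** The positive and negative parts of [h] give two finite measures, which are pushed forward by
    [T]. Their difference is [nu], which is all that [charge_integralE] asks; they need not be its
    Jordan decomposition, as [T] may merge the two parts. *)
Lemma charge_integral_density (nu : charge_on_line) (T h f : R -> R) (E : set R) :
  measurable_fun setT T -> leb.-integrable setT (EFin \o h) ->
  (forall A : set R, measurable A -> nu A = (\int[leb]_(s in T @^-1` A) h s)%:E) ->
  measurable_fun setT f -> (exists C, forall x, `|f x| <= C) -> measurable E ->
  charge_integral nu E f = \int[leb]_(s in T @^-1` E) (f (T s) * h s).
Proof.
move=> mT ih nuE mf [C fC] mE.
have mh : measurable_fun setT h by apply/measurable_EFinP; exact: measurable_int ih.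
have part (g : R -> R) : measurable_fun setT g -> (forall x, 0 <= g x) ->
    (forall x, g x <= `|h x|) ->
    leb.-integrable setT (EFin \o g) /\
    exists m : {finite_measure set (measurableTypeR R) -> \bar R},
      (forall A, measurable A -> m A = (\int[leb]_(s in T @^-1` A) g s)%:E) /\
      \int[m]_(x in E) f x = \int[leb]_(s in T @^-1` E) (f (T s) * g s).
  move=> mg g0 gh.
  have ig : leb.-integrable setT (EFin \o g).
    apply: (le_integrable measurableT _ _ ih); first exact/measurable_EFinP.
    by move=> x _ /=; rewrite lee_fin ger0_norm.
  split=> //.
  have [nu1 nu1E nu1f] := @density_measure _ (measurableTypeR R) leb g ig g0.
  have mTA A : measurable A -> measurable (T @^-1` A).
    by move=> mA; rewrite -[X in measurable X]setTI; exact: mT.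
  have [m mPE mPI] := @pushforward_finite_measure _ _ _ _ (T : measurableTypeR R -> measurableTypeR R) nu1 mT.
  have igA A : measurable A -> leb.-integrable A (EFin \o g).
    by move=> mA; exact: integrableS ig.
  exists m; split.
    move=> A mA; rewrite mPE nu1E; last exact: mTA.
    by rewrite /Rintegral fineK//; apply: integrable_fin_num; [|apply: igA]; exact: mTA.
  have nufT : nu1.-integrable (T @^-1` E) (EFin \o (f \o T)).
    apply: measurable_bounded_integrable; first exact: mTA.
    - by rewrite -ge0_fin_numE ?fin_num_measure//; exact: mTA.
    - by apply: measurable_funTS; apply: measurableT_comp.
    - exists C; split; first exact: num_real.
      by move=> M CM x _ /=; rewrite (le_trans (fC _))// ltW.
  rewrite /Rintegral (mPI (EFin \o f))//; last exact/measurable_EFinP.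
  congr fine.
  rewrite nu1f//; first exact: mTA.
have mhp : measurable_fun setT (fun x => Num.max (h x) 0).
  exact: measurable_maxr.
have mhn : measurable_fun setT (fun x => Num.max (- h x) 0).
  by apply: measurable_maxr => //; exact: measurableT_comp.
have [ip [mp [mpE fp]]] := part _ mhp (fun x => ltac:(by rewrite le_max lexx orbT))
   (fun x => ltac:(by rewrite ge_max ler_norm normr_ge0)).
have [in_ [mn [mnE fn]]] := part _ mhn (fun x => ltac:(by rewrite le_max lexx orbT))
   (fun x => ltac:(by rewrite ge_max -normrN ler_norm normr_ge0)).
have mTA A : measurable A -> measurable (T @^-1` A).
  by move=> mA; rewrite -[X in measurable X]setTI; exact: mT.
have hE x : h x = Num.max (h x) 0 - Num.max (- h x) 0.
  rewrite /Num.max oppr_lt0; case: ltP => h0; case: ltP => h1; lra.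
have iS (k : R -> R) A : measurable A -> leb.-integrable setT (EFin \o k) ->
   leb.-integrable (T @^-1` A) (EFin \o k).
  by move=> mA; apply: integrableS => //; exact: mTA.
have fTb : [bounded f (T x) | x in T @^-1` E].
  exists C; split; first exact: num_real.
  by move=> M CM x _ /=; rewrite (le_trans (fC _))// ltW.
have mfT : measurable_fun (T @^-1` E) (f \o T).
  by apply: measurable_funTS; exact: measurableT_comp.
have ifT (k : R -> R) : leb.-integrable setT (EFin \o k) ->
    leb.-integrable (T @^-1` E) (EFin \o (fun s => f (T s) * k s)).
  move=> ik; have := @integrableMr _ _ _ leb _ (mTA _ mE) _ _ mfT fTb (iS _ _ mE ik).
  by apply: eq_integrable => //; exact: mTA.
rewrite (@charge_integralE nu mp mn)//; last by exists C.
- rewrite fp fn -RintegralB; [|exact: mTA|exact: ifT|exact: ifT].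
  by apply: eq_Rintegral => x _; rewrite [in RHS]hE mulrBr.
- move=> A mA; rewrite nuE// mpE// mnE// -EFinB; congr (_%:E).
  rewrite -RintegralB; [|exact: mTA|exact: iS|exact: iS].
  by apply: eq_Rintegral => x _; rewrite [in LHS]hE.
Qed.

End DensityCharge.

(** * Fubini's theorem for real-valued integrals *)

Section Fubini.
Context {R : realType}.
Notation leb := (@lebesgue_measure R).

Lemma product_integrable (f : R * R -> R) (a b : R -> R) :
  measurable_fun setT f ->
  leb.-integrable setT (EFin \o a) -> leb.-integrable setT (EFin \o b) ->
  (forall x y, `|f (x, y)| <= `|a x| * `|b y|) ->
  (leb \x leb)%E.-integrable setT (EFin \o f).
Proof.
move=> mf ia ib fab; apply/integrable12ltyP; first exact/measurable_EFinP.
have [mea iaoo] := integrableP _ _ _ ia.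
have [meb iboo] := integrableP _ _ _ ib.
have ma : measurable_fun setT a by exact/measurable_EFinP.
have mb : measurable_fun setT b by exact/measurable_EFinP.
have ma' : measurable_fun setT (fun x => `|a x|%:E).
  by apply/measurable_EFinP; exact: measurableT_comp.
have mb' : measurable_fun setT (fun x => `|b x|%:E).
  by apply/measurable_EFinP; exact: measurableT_comp.
have key : (\int[leb]_x \int[leb]_y `|f (x, y)|%:E <=
    \int[leb]_x (`|a x|%:E * \int[leb]_y `|b y|%:E))%E.
  apply: ge0_le_integral => //.
  - by move=> x _; exact: integral_ge0.
  - have mf' : measurable_fun setT (fun z => `|f z|%:E).
      by apply/measurable_EFinP; exact: measurableT_comp.
    by have := @measurable_fun_fubini_tonelli_F _ _ (measurableTypeR R) (measurableTypeR R) R leb _ mf'; apply.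
  - exact: emeasurable_funM.
  - move=> x _; rewrite -ge0_integralZl//.
    apply: ge0_le_integral => //.
    + apply/measurable_EFinP; apply: measurableT_comp => //.
      exact: measurable_fun_pair2.
    + exact: emeasurable_funM.
    + by move=> y _; rewrite -EFinM lee_fin.
apply: (le_lt_trans key).
rewrite ge0_integralZr//; last exact: integral_ge0.
by apply: lte_mul_pinfty => //; [exact: integral_ge0|
  rewrite ge0_fin_numE//; exact: integral_ge0].
Qed.

(** With every slice integrable, not just almost every one, the inner integrals are finite
    everywhere and [fine] can be removed from them. *)
Lemma Rintegral_fubini (f : R * R -> R) :
  (leb \x leb)%E.-integrable setT (EFin \o f) ->
  (forall x, leb.-integrable setT (fun y => (f (x, y))%:E)) ->
  (forall y, leb.-integrable setT (fun x => (f (x, y))%:E)) ->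
  \int[(leb \x leb)%E]_z f z = \int[leb]_x \int[leb]_y f (x, y) /\
  \int[(leb \x leb)%E]_z f z = \int[leb]_y \int[leb]_x f (x, y).
Proof.
move=> intf f1 f2; rewrite /Rintegral; split; congr fine.
  rewrite -(integral12_prod_meas1 intf); apply: eq_integral => x _; rewrite /fubini_F fineK//.
  exact: integrable_fin_num.
rewrite -(integral21_prod_meas1 intf); apply: eq_integral => y _; rewrite /fubini_G fineK//.
exact: integrable_fin_num.
Qed.

End Fubini.

(** * Compactly supported [C^1] test functions on the line *)

Section TestFunctions.
Context {R : realType}.
Notation leb := (@lebesgue_measure R).

Lemma near0_notin_support (V : topologicalType) (f : V -> R) x :
  ~ closure [set x | f x != 0] x -> \near x, f x = 0.
Proof.
rewrite /closure/= => /existsNP[A /not_implyP[nA A0]].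
near=> y; apply/eqP/negPn/negP => fy; apply: A0; exists y; split=> //.
by near: y.
Unshelve. all: by end_near. Qed.

Lemma compact_norm_bound (V : normedModType R) (K : set V) :
  compact K -> exists2 B, 0 < B & forall x, K x -> `|x| <= B.
Proof.
move=> /compact_bounded[M [_ MB]].
exists (`|M| + 1) => [|x Bx]; first by rewrite ltr_wpDl.
by apply: MB => //; rewrite (le_lt_trans (ler_norm M))// ltrDl.
Qed.

Lemma continuous_bounded_off_compact (V : topologicalType) (f : V -> R) (K : set V) :
  {within K, continuous f} -> compact K -> (forall x, ~ K x -> f x = 0) ->
  exists2 C, 0 < C & forall x, `|f x| <= C.
Proof.
move=> cf cK f0; have [C C0 fC] := compact_norm_bound _ _ (continuous_compact cf cK).
exists C => // x; have [Kx|/f0 ->] := pselect (K x); first by apply: fC; exists x.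
by rewrite normr0 ltW.
Qed.

Lemma bounded_support_integrable (f : R -> R) (B C : R) :
  measurable_fun setT f -> (forall x, `|f x| <= C) -> (forall x, B < `|x| -> f x = 0) ->
  leb.-integrable setT (EFin \o f).
Proof.
move=> mf fC fB.
have mB : measurable (`[- B, B]%classic : set (measurableTypeR R)) by exact: measurable_itv.
have -> : EFin \o f = (EFin \o f) \_ `[- B, B].
  apply/funext => x; rewrite patchE; case: ifPn => //.
  rewrite notin_setE/= in_itv/= => /negP; rewrite -ler_norml -ltNge => /fB.
  by move=> /= ->.
apply: (iffLR (@integrable_mkcond _ (measurableTypeR R) R leb _ (EFin \o f) mB)).
apply: measurable_bounded_integrable => //.
- rewrite [ltLHS]lebesgue_measure_itv/= lte_fin; case: ifP => _; last by rewrite ltry.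
  by rewrite -EFinD ltry.
- exact: measurable_funTS.
- exists C; split; first exact: num_real.
  by move=> M CM x _ /=; rewrite (le_trans (fC x))// ltW.
Qed.

Lemma C1_compact_supportP (theta : R -> R) : C1_compact_support theta ->
  exists B C : R, [/\ 0 < B, forall x, `|theta x| <= C, forall x, `|derive1 theta x| <= C,
    forall x, B < `|x| -> theta x = 0 & forall x, B < `|x| -> derive1 theta x = 0].
Proof.
move=> [dt cdt ct].
have ctheta : continuous theta.
  by move=> x; apply/differentiable_continuous/derivable1_diffP.
have [B B0 tB] := compact_norm_bound _ _ ct.
have t0 x : ~ closure [set x | theta x != 0] x -> theta x = 0.
  by move=> /near0_notin_support /nbhs_singleton.
have dt0 x : ~ closure [set x | theta x != 0] x -> derive1 theta x = 0.
  move=> /near0_notin_support tx.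
  by rewrite derive1E (near_eq_derive (g := cst 0))// derive_cst.
have [C1 C10 tC1] := continuous_bounded_off_compact _ _ _ (continuous_subspaceT ctheta) ct t0.
have [C2 C20 tC2] := continuous_bounded_off_compact _ _ _ (continuous_subspaceT cdt) ct dt0.
exists B, (C1 + C2); split=> //.
- by move=> x; rewrite (le_trans (tC1 x))// lerDl ltW.
- by move=> x; rewrite (le_trans (tC2 x))// lerDr ltW.
- by move=> x Bx; apply: t0 => /tB; rewrite leNgt Bx.
- by move=> x Bx; apply: dt0 => /tB; rewrite leNgt Bx.
Qed.

Lemma C1_FTC (theta : R -> R) (x y : R) : C1_compact_support theta -> x <= y ->
  \int[leb]_(s in `[x, y]) derive1 theta s = theta y - theta x.
Proof.
move=> [dt cdt _]; rewrite le_eqVlt => /predU1P[->|xy].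
  by rewrite set_itv1 Rintegral_set1 subrr.
have ctheta : continuous theta.
  by move=> z; apply/differentiable_continuous/derivable1_diffP.
have cw : {within `[x, y], continuous (derive1 theta)} by exact: continuous_subspaceT.
have dLR : derivable_oo_LRcontinuous theta x y.
  by split=> //; apply: cvg_within_filter; exact: ctheta.
by have /(congr1 fine) := continuous_FTC2 xy cw dLR (fun z _ => erefl); apply.
Qed.

(** The value of [chi] at the step is left free: the lemma is applied to the indicator of [s < W y]
    as a function of [y], which steps at [T s] and whose value there is not known. *)
Lemma integral_step_derive1 (theta chi : R -> R) (x : R) : C1_compact_support theta ->
  measurable_fun setT chi ->
  (forall y, x < y -> chi y = 1) -> (forall y, y < x -> chi y = 0) ->
  \int[leb]_y (chi y * derive1 theta y) = - theta x.
Proof.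
move=> t1 mchi chi1 chi0.
have [B [C [B0 tC dC tB dB]]] := C1_compact_supportP _ t1.
have [_ cdt _] := t1.
have mdt : measurable_fun setT (derive1 theta) by exact: continuous_measurable_fun.
(* [b] lies to the right of both [x] and the support, so [theta b = 0]. *)
pose b : R := `|x| + B + 1.
have b0 : 0 <= b by rewrite /b; have := normr_ge0 x; lra.
have Bb : B < `|b| by rewrite ger0_norm// /b; have := normr_ge0 x; lra.
have xb : x <= b by rewrite /b; have := ler_norm x; lra.
rewrite -[RHS]add0r -(tB _ Bb) -C1_FTC//.
rewrite [RHS]Rintegral_mkcond /Rintegral; congr fine.
apply: ae_eq_integral => //.
- by apply/measurable_EFinP; exact: measurable_funM.
- apply/measurable_EFinP; apply/(measurable_restrictT _ _).1; first exact: measurable_itv.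
  exact: measurable_funTS.
exists [set x]; split; [exact: measurable_set1|exact: lebesgue_measure_set1|].
move=> y /= /not_implyP[_]; apply: contra_notP => yx.
congr (_%:E); rewrite patchE; case: ifPn => [|].
  rewrite inE/= in_itv/= => /andP[xy _]; rewrite chi1 ?mul1r//.
  by rewrite lt_neqAle xy andbT; apply/eqP => /esym.
rewrite notin_setE/= in_itv/=; have [xy /=|yx'] := leP x y; last by rewrite chi0// mul0r.
move=> /negP; rewrite -ltNge => by_; rewrite dB ?mulr0//.
rewrite ger0_norm; first by move: by_; rewrite /b; have := normr_ge0 x; lra.
by move: by_; rewrite /b; have := normr_ge0 x; lra.
Qed.

Lemma integral_derive1_0 (theta : R -> R) : C1_compact_support theta ->
  \int[leb]_y derive1 theta y = 0.
Proof.
move=> t1; have [B [C [B0 tC dC tB dB]]] := C1_compact_supportP _ t1.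
have [_ cdt _] := t1.
(* A step to the left of the support: [theta x = 0], and [chi] is 1 wherever the derivative may be
   nonzero. *)
pose x : R := - B - 1; pose chi (y : R) : R := (x < y)%R%:R.
have mchi : measurable_fun setT chi.
  have -> : chi = fun y => if x < y then 1 else 0.
    by apply/funext => y; rewrite /chi; case: ifP.
  by apply: measurable_fun_ifT => //; exact: measurable_fun_ltr.
have xB : B < `|x| by rewrite ler0_norm /x; lra.
have := integral_step_derive1 theta chi x t1 mchi.
rewrite tB// oppr0 => <-.
- apply: eq_Rintegral => y _; rewrite /chi; case: ltP => xy; first by rewrite mul1r.
  rewrite dB ?mulr0// ler0_norm; first by move: xy; rewrite /x; lra.
  by move: xy; rewrite /x; lra.
- by move=> y xy; rewrite /chi xy.
- by move=> y yx; rewrite /chi ltNge ltW.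
Qed.

End TestFunctions.

Section TimeChangedCharge.
Context {R : realType}.
Notation leb := (@lebesgue_measure R).
Notation charge_on_line := (charge (measurableTypeR R) R).

Lemma density_charge (T h : R -> R) :
  measurable_fun setT T -> leb.-integrable setT (EFin \o h) ->
  exists nu : charge_on_line,
    forall A : set R, measurable A -> nu A = (\int[leb]_(s in T @^-1` A) h s)%:E.
Proof.
move=> mT ih; have ih' := ih.
pose nu0 : charge_on_line :=
  pushforward (induced_charge ih) (T : measurableTypeR R -> measurableTypeR R).
exists (nu0 mT) => A mA; rewrite /nu0 /= /pushforward /induced_charge.
rewrite /Rintegral fineK//; apply: integrable_fin_num.
  by rewrite -[X in measurable X]setTI; exact: mT.
apply: integrableS ih' => //.
by rewrite -[X in measurable X]setTI; exact: mT.
Qed.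

(** Fubini for [h s * theta' y] on the region [s < W y]. Integrating in [y] first meets a step at
    [T s] and gives [- theta (T s) * h s]; integrating in [s] first gives [(f y - c) * theta' y],
    whose constant [c] drops out because [theta'] has integral 0. *)
Lemma distributional_derivative_density (W T h f : R -> R) (w0 w1 c : R)
    (nu : charge_on_line) :
  {homo W : x y / x <= y} -> measurable_fun setT T ->
  (forall s x, w0 < s -> s < w1 -> T s < x -> s < W x) ->
  (forall s x, w0 < s -> s < w1 -> s < W x -> T s <= x) ->
  leb.-integrable setT (EFin \o h) ->
  (forall s, ~~ (w0 < s < w1) -> h s = 0) ->
  (forall A : set R, measurable A -> nu A = (\int[leb]_(s in T @^-1` A) h s)%:E) ->
  measurable_fun setT f -> (exists C, forall x, `|f x| <= C) ->
  (forall y, \int[leb]_s ((s < W y)%R%:R * h s) = f y - c) ->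
  distributional_derivative f nu.
Proof.
move=> ndW mT TW1 TW2 ih h0 nuE mf [Cf fC] hf theta t1.
have [B [C [B0 tC dC tB dB]]] := C1_compact_supportP _ t1.
have [_ cdt _] := t1.
have mdt : measurable_fun setT (derive1 theta) by exact: continuous_measurable_fun.
have mt : measurable_fun setT theta.
  apply: continuous_measurable_fun => x.
  by apply/differentiable_continuous/derivable1_diffP; case: t1.
have idt : leb.-integrable setT (EFin \o derive1 theta).
  exact: (bounded_support_integrable _ B C).
have ift : leb.-integrable setT (EFin \o (fun y => f y * derive1 theta y)).
  apply: (bounded_support_integrable _ B (Cf * C)).
  - exact: measurable_funM.
  - by move=> x; rewrite normrM ler_pM.
  - by move=> x Bx; rewrite dB// mulr0.
rewrite (@charge_integral_density _ nu T h)//; last by exists C.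
rewrite preimage_setT.
have mh : measurable_fun setT h by apply/measurable_EFinP; exact: measurable_int ih.
have mW : measurable_fun setT W by exact: nondecreasing_measurable.
pose chi (z : R * R) : R := (z.1 < W z.2)%R%:R.
have mchi : measurable_fun setT chi.
  have -> : chi = fun z => if z.1 < W z.2 then 1 else 0.
    by apply/funext => z; rewrite /chi; case: ifP.
  apply: measurable_fun_ifT => //; apply: measurable_fun_ltr => //.
  exact: measurableT_comp.
have chi1 z : `|chi z| <= 1 by rewrite /chi; case: (_ < _)%R; rewrite ?normr1 ?normr0.
pose k (z : R * R) := h z.1 * (chi z * derive1 theta z.2).
have mk : measurable_fun setT k.
  apply: measurable_funM; first exact: measurableT_comp.
  by apply: measurable_funM => //; exact: measurableT_comp.
have kle x y : `|k (x, y)| <= `|h x| * `|derive1 theta y|.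
  by rewrite /k !normrM/= ler_wpM2l// ler_piMl.
have ik := @product_integrable _ k h (derive1 theta) mk ih idt kle.
have ik1 x : leb.-integrable setT (fun y => (k (x, y))%:E).
  apply: (@le_integrable _ _ _ leb _ _ _ (fun y => (h x)%:E * (derive1 theta y)%:E)%E) => //.
  - by apply/measurable_EFinP; exact: measurable_fun_pair2.
  - by move=> y _; rewrite -EFinM lee_fin normrM; exact: kle.
  - exact: integrableZl.
have ik2 y : leb.-integrable setT (fun x => (k (x, y))%:E).
  apply: (@le_integrable _ _ _ leb _ _ _ (fun x => (h x)%:E * (derive1 theta y)%:E)%E) => //.
  - by apply/measurable_EFinP; exact: measurable_fun_pair1.
  - by move=> x _; rewrite -EFinM lee_fin normrM; exact: kle.
  - exact: integrableZr.
have [F1 F2] := @Rintegral_fubini _ k ik ik1 ik2.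
have ichi x : leb.-integrable setT (EFin \o (fun y => chi (x, y) * derive1 theta y)).
  apply: (le_integrable measurableT _ _ idt).
  - apply/measurable_EFinP; apply: measurable_funM => //.
    exact: measurable_fun_pair2.
  - by move=> y _; rewrite /= lee_fin normrM ler_piMl.
have ichi2 y : leb.-integrable setT (EFin \o (fun x => chi (x, y) * h x)).
  apply: (le_integrable measurableT _ _ ih).
  - apply/measurable_EFinP; apply: measurable_funM => //.
    exact: measurable_fun_pair1.
  - by move=> x _; rewrite /= lee_fin normrM ler_piMl.
have iTh : leb.-integrable setT (EFin \o (fun s => theta (T s) * h s)).
  apply: (@le_integrable _ _ _ leb _ _ _ (fun y => C%:E * (h y)%:E)%E) => //.
  - by apply/measurable_EFinP; apply: measurable_funM => //; exact: measurableT_comp.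
  - move=> s _; rewrite -EFinM lee_fin/= !normrM ler_wpM2r//.
    by rewrite (le_trans (tC _))// ler_norm.
  - exact: integrableZl.
have kE s : \int[leb]_y k (s, y) = -1 * (theta (T s) * h s).
  (* Outside []w0, w1[] nothing ties [T] to [W]; there the identity holds because [h s = 0]. *)
  have [/andP[s0 s1]|/h0 hs0] := boolP (w0 < s < w1); last first.
    rewrite hs0 !mulr0 (_ : (fun y => k (s, y)) = cst 0); last first.
      by apply/funext => y; rewrite /k/= hs0 mul0r.
    by rewrite Rintegral_cst// mul0r.
  transitivity (h s * \int[leb]_y (chi (s, y) * derive1 theta y)).
    exact: (@RintegralZl _ _ _ leb setT _ (h s) measurableT (ichi s)).
  rewrite (@integral_step_derive1 _ theta (fun y => chi (s, y)) (T s))//.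
  - by rewrite mulN1r mulrN mulrC.
  - exact: measurable_fun_pair2.
  - by move=> y Ty; rewrite /chi/= (TW1 _ _ s0 s1 Ty).
  - by move=> y yT; rewrite /chi/=; case: ltP => // /(TW2 _ _ s0 s1); rewrite leNgt yT.
have E1 : \int[leb]_x \int[leb]_y k (x, y) = - \int[leb]_s (theta (T s) * h s).
  transitivity (\int[leb]_s (-1 * (theta (T s) * h s))).
    by apply: eq_Rintegral => s _; exact: kE.
  by rewrite RintegralZl// mulN1r.
rewrite -[LHS]opprK -E1 -F1 F2; congr (- _).
transitivity (\int[leb]_y (f y * derive1 theta y - c * derive1 theta y)).
  apply: eq_Rintegral => y _; rewrite -mulrBl -hf -RintegralZr//.
    by apply: eq_Rintegral => x _; rewrite /k /chi/=; ring.
  exact: ichi2.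
rewrite RintegralB//.
  by rewrite RintegralZl// integral_derive1_0// mulr0 subr0.
exact: (integrableZl measurableT c idt).
Qed.

End TimeChangedCharge.

Section MonotoneLimits.
Context {R : realType}.

Lemma nondecreasing_cvg_at_left (W : R -> R) (x : R) : {homo W : y z / y <= z} ->
  W y @[y --> x^'-] --> sup (W @` `]-oo, x[).
Proof.
move=> ndW; have S0 : W @` `]-oo, x[ !=set0.
  by exists (W (x - 1)), (x - 1) => //=; rewrite in_itv/= gtrBl.
have Sub : has_ubound (W @` `]-oo, x[).
  by exists (W x) => _ [y /= yx <-]; apply: ndW; apply: ltW; move: yx; rewrite in_itv.
apply/cvgrPdist_lt => e e0.
have [_ [y0 /= y0x <-] ey0] := sup_adherent e0 (conj S0 Sub).
move: y0x; rewrite in_itv/= => y0x.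
near=> y.
have y0y : y0 < y by near: y; exact: nbhs_left_gt.
have yx : y < x by near: y; exact: nbhs_left_lt.
have Wy : W y <= sup (W @` `]-oo, x[).
  by apply: ub_le_sup => //; exists y => //=; rewrite in_itv.
rewrite ger0_norm ?subr_ge0//; have := ndW _ _ (ltW y0y); move: ey0; lra.
Unshelve. all: by end_near. Qed.

Lemma nondecreasing_cvg_at_right (W : R -> R) (x : R) : {homo W : y z / y <= z} ->
  W y @[y --> x^'+] --> inf (W @` `]x, +oo[).
Proof.
move=> ndW; apply: (@nondecreasing_at_right_cvgr _ W x +oo%O) => //.
  by move=> y z _ _; exact: ndW.
by exists (W x) => _ [y /= + <-]; rewrite in_itv/= andbT => /ltW /ndW.
Qed.

End MonotoneLimits.

(** * The derivative of a Lipschitz function of a monotone function *)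

Section LipschitzCharge.
Context {R : realType}.
Notation leb := (@lebesgue_measure R).
Notation charge_on_line := (charge (measurableTypeR R) R).

Lemma integral_itv_endpoints (g : R -> R) (a b : R) : measurable_fun setT g ->
  \int[leb]_(s in `]a, b[) g s = \int[leb]_(s in `]a, b]) g s.
Proof.
move=> mg; rewrite /Rintegral integral_itv_bndo_bndc//.
by apply/measurable_EFinP; exact: measurable_funTS.
Qed.

(** [nu] is the image under [T] of [F' ds], cut off outside []w0, w1[]. Its mass at [x] integrates
    [F'] over the fibre of [T] at [x], which is the gap between the one-sided limits of [W] at [x],
    up to end points; hence the jump of [F o W]. *)
Lemma lipschitz_charge (W T F : R -> R) (w0 w1 L : R) :
  {homo W : x y / x <= y} -> measurable_fun setT T ->
  (forall x, w0 <= W x <= w1) ->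
  (forall s x, w0 < s -> s < w1 -> T s < x -> s < W x) ->
  (forall s x, w0 < s -> s < w1 -> s < W x -> T s <= x) ->
  0 < L -> (forall s t, `|F s - F t| <= L * `|s - t|) ->
  exists (h : R -> R) (nu : charge_on_line),
    [/\ leb.-integrable setT (EFin \o h),
      forall s, ~~ (w0 < s < w1) -> h s = 0,
      {ae leb, forall s : R, w0 < s -> s < w1 -> is_derive s 1 F (h s)},
      forall A : set R, measurable A -> nu A = (\int[leb]_(s in T @^-1` A) h s)%:E &
      distributional_derivative (F \o W) nu] /\
      forall (x Fl Fr : R), F (W y) @[y --> x^'-] --> Fl -> F (W y) @[y --> x^'+] --> Fr ->
        nu [set x] = (Fr - Fl)%:E.
Proof.
move=> ndW mT Ww TW1 TW2 L0 FL.
have w01 : w0 <= w1 by have /andP[] := Ww 0; exact: le_trans.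
have cF := lipschitz_continuous _ _ FL.
have [h0 [mh0 ih0 h0E dF]] := lipschitz_FTC L F w0 w1 L0 FL.
pose h := h0 \_ (`]w0, w1[%classic : set R).
have mI : measurable (`]w0, w1[%classic : set (measurableTypeR R)) by exact: measurable_itv.
have ih : leb.-integrable setT (EFin \o h).
  rewrite /h -restrict_EFin.
  apply: (iffLR (@integrable_mkcond _ (measurableTypeR R) R leb _ (EFin \o h0) mI)).
  have mI' : measurable (`]w0, w1]%classic : set (measurableTypeR R)) by exact: measurable_itv.
  apply: (integrableS mI' mI _ ih0).
  by move=> z /=; rewrite !in_itv/= => /andP[-> /ltW].
have hN s : ~~ (w0 < s < w1) -> h s = 0.
  by move=> /negP s01; rewrite /h patchE ifN// notin_setE/= in_itv/=.
have hI s : w0 < s -> s < w1 -> h s = h0 s.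
  by move=> s0 s1; rewrite /h patchE ifT// inE/= in_itv/= s0.
have [nu nuE] := density_charge T h mT ih.
have mW : measurable_fun setT W by exact: nondecreasing_measurable.
exists h, nu; split; first split=> //.
- move: dF; apply: filterS; first exact: (ae_filter_ringOfSetsType leb).
  by move=> s ds s0 s1; rewrite hI//; exact: ds.
- have FWb : exists C, forall x, `|(F \o W) x| <= C.
    exists (`|F w0| + L * (w1 - w0)) => x /=.
    have /andP[Wx0 Wx1] := Ww x.
    rewrite -[F (W x)](subrKC (F w0)) (le_trans (ler_normD _ _))// lerD2l.
    by rewrite (le_trans (FL _ _))// ler_wpM2l ?(ltW L0)// ger0_norm ?subr_ge0// lerB.
  apply: (distributional_derivative_density W T h _ w0 w1 (F w0) nu) => //.
    by apply: measurableT_comp => //; exact: continuous_measurable_fun.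
  (* The constant is [F w0], since [h] is integrated from [w0] up to [W y]. *)
  move=> y; have /andP[Wy0 Wy1] := Ww y.
  rewrite -(h0E _ _ (lexx _) Wy0 Wy1) -integral_itv_endpoints// [RHS]Rintegral_mkcond.
  apply: eq_Rintegral => s _; rewrite patchE.
  case: ifPn => [|].
    rewrite inE/= in_itv/= => /andP[s0 sW]; rewrite sW mul1r hI//.
    exact: lt_le_trans Wy1.
  rewrite notin_setE/= in_itv/=; have [s0 /= /negP/negbTE ->|s0 _] := ltP w0 s.
    by rewrite mul0r.
  by rewrite hN ?mulr0// ltNge s0.
- move=> x Fl Fr Fxl Fxr.
  (* [a] and [b] are the left and right limits of [W] at [x]. *)
  set a := sup (W @` `]-oo, x[); set b := inf (W @` `]x, +oo[).
  have Wl : W y @[y --> x^'-] --> a by exact: nondecreasing_cvg_at_left.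
  have Wr : W y @[y --> x^'+] --> b by exact: nondecreasing_cvg_at_right.
  have FlE : Fl = F a.
    by apply: (cvg_unique (@Rhausdorff R) Fxl); exact: (cvg_comp W F Wl (cF a)).
  have FrE : Fr = F b.
    by apply: (cvg_unique (@Rhausdorff R) Fxr); exact: (cvg_comp W F Wr (cF b)).
  have aW y : y < x -> W y <= a.
    move=> yx; apply: ub_le_sup; last by exists y => //=; rewrite in_itv.
    by exists w1 => _ [z _ <-]; have /andP[] := Ww z.
  have bW y : x < y -> b <= W y.
    move=> xy; apply: ge_inf; last by exists y => //=; rewrite in_itv/= xy.
    by exists w0 => _ [z _ <-]; have /andP[] := Ww z.
  have leb_a u : (forall y, y < x -> W y <= u) -> a <= u.
    move=> Wu; apply: ge_sup.
      by exists (W (x - 1)), (x - 1) => //=; rewrite in_itv/= gtrBl.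
    by move=> _ [y /= yx <-]; apply: Wu; move: yx; rewrite in_itv.
  have geb_b u : (forall y, x < y -> u <= W y) -> u <= b.
    move=> Wu; apply: lb_le_inf.
      by exists (W (x + 1)), (x + 1) => //=; rewrite in_itv/= ltrDl ltr01.
    by move=> _ [y /= + <-]; rewrite in_itv/= andbT; exact: Wu.
  have a0 : w0 <= a.
    by have /andP[W0 _] := Ww (x - 1); rewrite (le_trans W0)// aW// gtrBl.
  have b1 : b <= w1.
    by have /andP[_ W1] := Ww (x + 1); rewrite (le_trans _ W1)// bW// ltrDl.
  have ab : a <= b.
    by apply: leb_a => y yx; apply: geb_b => z xz; apply: ndW; rewrite ltW// (lt_trans yx).
  rewrite nuE; last exact: measurable_set1.
  rewrite FlE FrE -(h0E _ _ a0 ab b1) -integral_itv_endpoints//; congr (_%:E).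
  rewrite [LHS]Rintegral_mkcond [RHS]Rintegral_mkcond /Rintegral; congr fine.
  have mTx : measurable (T @^-1` [set x]).
    by rewrite -[X in measurable X]setTI; apply: mT => //; exact: measurable_set1.
  apply: ae_eq_integral => //.
  + apply/measurable_EFinP; apply/(measurable_restrictT _ _).1 => //.
    apply: measurable_funTS; apply/measurable_EFinP; exact: measurable_int ih.
  + apply/measurable_EFinP; apply/(measurable_restrictT _ _).1; first exact: measurable_itv.
    exact: measurable_funTS.
  (* Whether [T] maps the end points to [x] is not determined. For any other [s] in []w0, w1[],
     [T s = x] exactly when [a < s < b]; elsewhere [h] vanishes. *)
  + exists [set a; b]; split.
    * exact: measurableU (measurable_set1 _) (measurable_set1 _).
    * by apply: countable_lebesgue_measure0; apply: finite_set_countable; exact: finite_set2.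
    * move=> s /= /not_implyP[_]; apply: contra_notP => /not_orP[sa sb].
      congr (_%:E); rewrite !patchE.
      have [/andP[s0 s1]|s01] := boolP (w0 < s < w1); last first.
        rewrite hN// if_same; case: ifPn => //; rewrite inE/= in_itv/= => /andP[as_ sb_].
        by move: s01; rewrite (le_lt_trans a0 as_) (lt_le_trans sb_ b1).
      rewrite hI//; congr (if _ then _ else _); apply/idP/idP; rewrite !inE/= in_itv/=.
      - move=> Tsx; apply/andP; split; rewrite lt_neqAle; apply/andP; split.
        + by apply/eqP => /esym.
        + apply: leb_a => y yx; rewrite leNgt; apply/negP => /(TW2 _ _ s0 s1).
          by rewrite Tsx leNgt yx.
        + exact/eqP.
        + by apply: geb_b => y xy; apply: ltW; apply: TW1 => //; rewrite Tsx.
      - move=> /andP[as_ sb_]; apply/le_anti/andP; split.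
        + apply/ler_addgt0Pr => e e0; apply: TW2 => //.
          by rewrite (lt_le_trans sb_)// bW// ltrDl.
        + rewrite leNgt; apply/negP => Tx.
          have [y /andP[Ty yx]] : exists y, T s < y < x.
            by exists ((T s + x) / 2); apply/andP; split; move: Tx; lra.
          by have := lt_le_trans (TW1 _ _ s0 s1 Ty) (aW _ yx); rewrite ltNge (ltW as_).
Qed.

End LipschitzCharge.

(** * Chain rule for functions of bounded variation *)

Section ChainRule.
Context {R : realType}.
Notation leb := (@lebesgue_measure R).
Notation charge_on_line := (charge (measurableTypeR R) R).

Lemma derive_grad n (q : 'rV[R]_n -> R) (U v : 'rV[R]_n) : differentiable q U ->
  'D_v q U = \sum_i grad q U 0 i * v 0 i.
Proof.
move=> dq; rewrite deriveE// {1}(matrix_sum_delta v) big_ord_recl big_ord0 addr0.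
rewrite linear_sum; apply: eq_bigr => i _.
by rewrite linearZ/= mxE deriveE// mulrC.
Qed.

Lemma is_derive_comp_grad n (g d : R -> 'rV[R]_n) (q : 'rV[R]_n -> R) (s : R) :
  (forall i, is_derive s 1 (fun t => g t 0 i) (d s 0 i)) ->
  differentiable q (g s) ->
  is_derive s 1 (q \o g) (\sum_i grad q (g s) 0 i * d s 0 i).
Proof.
move=> dg dq.
have derg : derivable g s 1.
  by apply/derivable_mxP => i j; rewrite ord1; case: (dg j).
have diffg : differentiable g s by exact/derivable1_diffP.
have dqg : differentiable (q \o g) s by exact: differentiable_comp.
split; first exact/derivable1_diffP.
rewrite deriveE// diff_comp//= -!deriveE// derive_grad//.
apply: eq_bigr => i _; congr (_ * _).
rewrite derive_mx// mxE; exact: (@derive_val _ _ _ _ _ _ _ (dg i)).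
Qed.

(* [D] vanishes on the values of [W], but these may fill no neighbourhood of
   [s]: a derivative that is known to exist can be computed along them. *)
Lemma derive_eq0_along (D W : R -> R) (s d x : R) : is_derive s 1 D d ->
  W y @[y --> x^'+] --> s -> (forall y, x < y -> s < W y) ->
  (forall y, x < y -> D (W y) = 0) -> D s = 0 -> d = 0.
Proof.
move=> dD Ws sW DW Ds.
have quot : h^-1 *: (D (h *: 1 + s) - D s) @[h --> 0^'] --> d.
  by have [/cvgP + <-] := dD.
have W0 : W y - s @[y --> x^'+] --> 0^'.
  move=> A; rewrite /dnbhs/= => nA.
  have : W y - s @[y --> x^'+] --> (0 : R).
    by rewrite -(subrr s); apply: cvgB => //; exact: cvg_cst.
  move=> /(_ _ nA) WA.
  have {}WA : \forall y \near x^'+, W y - s != 0 -> A (W y - s) by exact: WA.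
  suff : \forall y \near x^'+, A (W y - s) by [].
  near=> y; have : x < y by near: y; exact: nbhs_right_gt.
  move=> /sW sWy; have : W y - s != 0 by rewrite subr_eq0 gt_eqF.
  by move: (near WA y); apply.
have := cvg_comp _ _ W0 quot.
move=> quot0; apply/esym; apply: (cvg_unique (@Rhausdorff R) _ quot0).
have : (0 : R) @[_ --> x^'+] --> (0 : R) by exact: cvg_cst.
apply: cvg_trans; apply: near_eq_cvg; near=> y.
have xy : x < y by near: y; exact: nbhs_right_gt.
by rewrite /= /GRing.scale/= mulr1 subrK DW// Ds subrr mulr0.
Unshelve. all: by end_near. Qed.

Lemma Rintegral_sum d (T : measurableType d) (mu : {measure set T -> \bar R})
    (D : set T) n (f : 'I_n -> T -> R) : measurable D ->
  (forall i, mu.-integrable D (EFin \o f i)) ->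
  \int[mu]_(x in D) \sum_i f i x = \sum_i \int[mu]_(x in D) f i x.
Proof.
move=> mD fi; apply: EFin_inj; rewrite -sumEFin {1}/Rintegral fineK.
  under eq_integral do rewrite -sumEFin.
  rewrite (integral_sum mD fi); apply: eq_bigr => i _.
  by rewrite fineK//; apply: integrable_fin_num => //; exact: fi.
apply: integrable_fin_num => //.
have := @integrable_sum _ _ _ mu _ mD _ (index_enum 'I_n) xpredT _ (fun i _ => fi i).
by apply: eq_integrable => // x _; rewrite -sumEFin.
Qed.

End ChainRule.

Section BVChainRule.
Context {R : realType}.
Notation leb := (@lebesgue_measure R).
Notation charge_on_line := (charge (measurableTypeR R) R).

Lemma rV_norm_le n (v : 'rV[R]_n) (c : R) : 0 <= c ->
  (forall i, `|v 0 i| <= c) -> `|v| <= c.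
Proof.
move=> c0 vc; rewrite /Num.Def.normr/= mx_normrE (bigmax_le _ c0)//= => -[i j] _.
by rewrite ord1.
Qed.

Lemma ler_coord_norm n (v : 'rV[R]_n) i : `|v 0 i| <= `|v|.
Proof.
by rewrite {2}/Num.Def.normr/= mx_normrE; exact: (le_bigmax _ _ (0, i)).
Qed.

(* With [W] the total variation of [V], both [V = F o W] and [q o V = G o W] for
   Lipschitz [F] and [G], and their derivatives are the images of the measures
   [F' ds] and [G' ds] under the inverse [T] of [W].  At almost every [s = W (T s)],
   [G'] and [grad q (V (T s)) . F'] agree as [G - q o F] vanishes along [W]. *)
Lemma BV_chain_rule n (V : R -> 'rV[R]_n) (K : set 'rV[R]_n) (q : 'rV[R]_n -> R)
    (L C : R) :
  BV V -> (forall x, K (V x)) -> 0 < L ->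
  (forall y z, K y -> K z -> `|q y - q z| <= L * `|y - z|) ->
  (forall U, K U -> differentiable q U) ->
  (forall i, measurable_fun setT (fun x => grad q (V x) 0 i)) ->
  (forall i x, `|grad q (V x) 0 i| <= C) ->
  exists (nu : 'I_n -> charge_on_line) (mu : charge_on_line),
    [/\ forall i, distributional_derivative (fun x => V x 0 i) (nu i),
      distributional_derivative (q \o V) mu,
      forall E : set R, measurable E -> E `<=` [set x | {for x, continuous V}] ->
        mu E = (\sum_(i < n) charge_integral (nu i) E (fun x => grad q (V x) 0 i))%:E &
      forall (x : R) (ql qr : R), q (V y) @[y --> x^'-] --> ql ->
        q (V y) @[y --> x^'+] --> qr -> mu [set x] = (qr - ql)%:E].
Proof.
move=> BVV KV L0 qL dq mB BC.
have [M [W [ndW WM WV Wc]]] := BV_parametrization _ V BVV.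
have [w0 [w1 [T [mT Ww TW1 TW2]]]] := time_change W M ndW WM.
have WV' i x y : `|V x 0 i - V y 0 i| <= `|W x - W y|.
  have [xy|/ltW yx] := leP x y.
    by rewrite distrC (distrC (W x)) (le_trans (WV i _ _ xy))// ler_norm.
  by rewrite (le_trans (WV i _ _ yx))// ler_norm.
have VW x y : `|V x - V y| <= `|W x - W y|.
  by apply: rV_norm_le => // i; rewrite !mxE; exact: WV'.
have /choice[F FP] i : exists F : R -> R, (forall s t, `|F s - F t| <= 1 * `|s - t|) /\
    forall x, F (W x) = V x 0 i.
  have [|F F1 F2] := @lipschitz_extension R W (fun x => V x 0 i) 1 ler01.
    by move=> x y; rewrite mul1r.
  by exists F.
have [|Q Q1 Q2] := @lipschitz_extension R W (q \o V) L (ltW L0).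
  by move=> x y; rewrite (le_trans (qL _ _ (KV _) (KV _)))// ler_wpM2l// ltW.
have /choice[h /choice[nu hnu]] i :=
  lipschitz_charge W T (F i) w0 w1 1 ndW mT Ww TW1 TW2 ltr01 (FP i).1.
have [k [mu [[ik k0 dQ muE dmu] jmu]]] := lipschitz_charge W T Q w0 w1 L ndW mT Ww TW1 TW2 L0 Q1.
exists nu, mu.
have QW : Q \o W = q \o V by apply/funext => x /=; rewrite Q2.
split.
- move=> i; have [[_ _ _ _ +] _] := hnu i.
  by congr distributional_derivative; apply/funext => x /=; rewrite (FP i).2.
- by rewrite -QW.
- move=> E mE EC.
  have mTE : measurable (T @^-1` E) by rewrite -[X in measurable X]setTI; exact: mT.
  have ih i : leb.-integrable setT (EFin \o h i) by have [[]] := hnu i.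
  have iBh i : leb.-integrable (T @^-1` E) (EFin \o (fun s => grad q (V (T s)) 0 i * h i s)).
    have mBT : measurable_fun (T @^-1` E) (fun s => grad q (V (T s)) 0 i).
      apply: measurable_funTS.
      exact: measurableT_comp (mB i) mT.
    have bBT : [bounded (grad q (V (T s)) 0 i) | s in T @^-1` E].
      exists C; split; first exact: num_real.
      by move=> N CN s _ /=; rewrite (le_trans (BC _ _))// ltW.
    have ihE : leb.-integrable (T @^-1` E) (EFin \o h i) by apply: integrableS (ih i).
    have := @integrableMr _ _ _ leb _ mTE _ _ mBT bBT ihE.
    by apply: eq_integrable.
  rewrite muE//; congr (_%:E).
  transitivity (\sum_i \int[leb]_(s in T @^-1` E) (grad q (V (T s)) 0 i * h i s)); last first.
    apply: eq_bigr => i _; have [[_ _ _ nuE _] _] := hnu i; apply/esym.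
    by apply: charge_integral_density => //; exists C.
  rewrite -Rintegral_sum// /Rintegral; congr fine.
  apply: ae_eq_integral => //.
  + by apply: (measurable_funS measurableT) => //; exact: measurable_int ik.
  + apply/measurable_EFinP; apply: measurable_sum => i.
    by apply/measurable_EFinP; exact: measurable_int (iBh i).
  have dF : {ae leb, forall s : R, forall i, w0 < s -> s < w1 -> is_derive s 1 (F i) (h i s)}.
    apply: (@filter_forall _ _ (fun i s => w0 < s -> s < w1 -> is_derive s 1 (F i) (h i s))
      _ (ae_filter_ringOfSetsType leb)).
    by move=> i; have [[]] := hnu i.
  have := @filterI _ _ (ae_filter_ringOfSetsType leb) _ _ dQ dF.
  apply: (@filterS _ _ (ae_filter_ringOfSetsType leb)).
  move=> s [dQs dFs] /= Es; congr (_%:E).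
  have [/andP[s0 s1]|s01] := boolP (w0 < s < w1); last first.
    rewrite k0// big1// => i _; have [[_ hi0 _ _ _] _] := hnu i.
    by rewrite hi0// mulr0.
  set x := T s in Es *.
  have cW : {for x, continuous W} by apply: Wc; exact: EC.
  have [Wl Wr] : W y @[y --> x^'-] --> W x /\ W y @[y --> x^'+] --> W x.
    exact/left_right_continuousP.
  (* To the left of [x = T s] the values of [W] are at most [s], to the right they exceed [s];
     continuity of [W] at [x] leaves only [s]. *)
  have Wx : W x = s.
    apply/le_anti/andP; split.
      apply: (cvgr_to_le Wl).
      near=> y; rewrite leNgt; apply/negP => /(TW2 _ _ s0 s1).
      by rewrite leNgt; apply/negP; rewrite negbK; near: y; exact: nbhs_left_lt.
    apply: (cvgr_to_ge Wr).
    near=> y; apply: ltW; apply: TW1 => //; near: y; exact: nbhs_right_gt.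
  have Fs : \row_i F i s = V x by apply/rowP => i; rewrite mxE -Wx (FP i).2.
  pose G := q \o (fun t => \row_i F i t).
  have dG : is_derive s 1 G (\sum_i grad q (V x) 0 i * h i s).
    have := @is_derive_comp_grad _ _ (fun t => \row_i F i t) (fun t => \row_i h i t) q s.
    rewrite Fs; under eq_bigr do rewrite mxE; apply.
      move=> i; rewrite mxE.
      have -> : (fun t => (\row_i F i t) 0 i) = F i by apply/funext => t; rewrite mxE.
      exact: dFs.
    exact: dq.
  apply/eqP; rewrite -subr_eq0; apply/eqP.
  apply: (derive_eq0_along (Q \- G) W s _ x).
  + by apply: is_deriveB => //; exact: dQs.
  + by rewrite -[X in _ --> X]Wx.
  + by move=> y xy; exact: TW1.
  + move=> y _ /=; rewrite Q2 /G/=; apply/eqP; rewrite subr_eq0; apply/eqP; congr q.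
    by apply/rowP => i; rewrite mxE (FP i).2.
  + by rewrite /= -{1}Wx Q2 /G/= Fs subrr.
- move=> x ql qr Hl Hr; apply: jmu.
    by under eq_fun do rewrite Q2.
  by under eq_fun do rewrite Q2.
Unshelve. all: by end_near. Qed.

End BVChainRule.

(** * Exactness of path integrals *)

Section NonmeasurableIntegrand.
Context d (T : measurableType d) (R : realType) (mu : {measure set T -> \bar R}).
Local Open Scope ereal_scope.
Import HBNNSimple.

(** The integral of an arbitrary nonnegative function is a supremum over simple functions below it.
    Setting such a function to 0 on [N] preserves its integral and brings it below [g]. *)
Lemma ge0_le_integral_off_null (f g : T -> \bar R) (N : set T) :
  measurable N -> mu N = 0 -> (forall x, 0 <= f x) -> (forall x, 0 <= g x) ->
  (forall x, ~ N x -> f x = g x) -> \int[mu]_x f x <= \int[mu]_x g x.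
Proof.
move=> mN N0 f0 g0 fg; rewrite !ge0_integralTE//.
apply: ge_ereal_sup => _ [h /= hf <-].
have mNC : measurable (~` N) by exact: measurableC.
have -> : sintegral mu h = sintegral mu (proj_nnsfun h mNC).
  rewrite -mrestrict -integral_nnsfun//.
  transitivity (\int[mu]_x (h x)%:E); first by rewrite integral_nnsfun// patch_setT.
  rewrite -(setTD N) -ge0_negligible_integral//.
  - by apply/measurable_EFinP; exact: measurable_funP.
  - by move=> x _; rewrite lee_fin.
apply: ereal_sup_ubound => /=; exists (proj_nnsfun h mNC) => // x.
rewrite -mrestrict patchE; case: ifPn => [|_]; last exact: g0.
by rewrite inE/= => /fg <-.
Qed.

Lemma ge0_eq_integral_off_null (f g : T -> \bar R) (N : set T) :
  measurable N -> mu N = 0 -> (forall x, 0 <= f x) -> (forall x, 0 <= g x) ->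
  (forall x, ~ N x -> f x = g x) -> \int[mu]_x f x = \int[mu]_x g x.
Proof.
move=> mN N0 f0 g0 fg; apply/le_anti/andP; split.
  exact: (ge0_le_integral_off_null _ _ N).
by apply: (ge0_le_integral_off_null _ _ N) => // x /fg.
Qed.

(* Unlike [ae_eq_integral], no measurability is required: the derivative of a
   Lipschitz path takes junk values where the path is not derivable. *)
Lemma eq_integral_off_null (D : set T) (f g : T -> \bar R) :
  {ae mu, forall x, D x -> f x = g x} ->
  \int[mu]_(x in D) f x = \int[mu]_(x in D) g x.
Proof.
move=> [N [mN N0 fgN]]; rewrite integral_mkcond [RHS]integral_mkcond.
have fg x : ~ N x -> (f \_ D) x = (g \_ D) x.
  move=> Nx; rewrite !patchE; case: ifPn => //; rewrite inE => Dx.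
  by apply: contrapT => fgx; apply/Nx/fgN => /= /(_ Dx).
rewrite integralE [RHS]integralE; congr (_ - _).
  by apply: (ge0_eq_integral_off_null _ _ N) => // x /fg; rewrite !funeposE => ->.
by apply: (ge0_eq_integral_off_null _ _ N) => // x /fg; rewrite !funenegE => ->.
Qed.

End NonmeasurableIntegrand.

(** * Lipschitz estimates for [C^1] functions on compact sets *)

Section LipschitzOnCompact.
Context {R : realType} (n : nat) (O : set 'rV[R]_n) (q : 'rV[R]_n -> R).
Hypothesis openO : open O.
Hypothesis dq : forall U, O U -> differentiable q U.
Hypothesis cdq : forall U i, O U -> {for U, continuous (fun W => grad q W 0 i)}.

Lemma C1_locally_lipschitz (x : 'rV[R]_n) : O x ->
  exists2 L : R, 0 < L & exists2 r, 0 < r &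
    forall y z, ball x r y -> ball x r z -> `|q y - q z| <= L * `|y - z|.
Proof.
move=> Ox.
(* By continuity, [c i] bounds the [i]-th partial derivative on a whole ball, to which the mean
   value theorem is applied along segments. *)
pose c i := `|grad q x 0 i| + 1.
have near_r : \forall y \near x, O y /\ forall i, `|grad q y 0 i| <= c i.
  near=> y; split; first by near: y; exact: open_nbhs_nbhs.
  near: y; apply: filter_forall => i.
  have /cvgrPdist_le /(_ 1 ltr01) := cdq x i Ox.
  apply: filterS => y xy; rewrite -lerBlDl.
  by rewrite (le_trans (lerB_dist _ _))// distrC.
have /nbhs_ballP[r /= r0 rP] := near_r.
(* The extra 1 keeps the constant positive even for [n = 0]. *)
exists (\sum_i c i + 1); first by rewrite ltr_wpDl// sumr_ge0// => i _; rewrite addr_ge0.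
exists r => // y z xy xz.
pose s (t : R) : 'rV[R]_n := z + t *: (y - z).
have sB (t : R) : 0 <= t -> t <= 1 -> ball x r (s t).
  move=> t0 t1; move: xy xz; rewrite -!ball_normE/= /s => xy xz.
  have -> : x - (z + t *: (y - z)) = (1 - t) *: (x - z) + t *: (x - y).
    by rewrite scalerBl scale1r !scalerBr; apply/rowP => j; rewrite !mxE; ring.
  rewrite (le_lt_trans (ler_normD _ _))// !normrZ (ger0_norm t0) ger0_norm ?subr_ge0//.
  have [->|t_neq0] := eqVneq t 0; first by rewrite mul0r addr0 subr0 mul1r.
  have t_gt0 : 0 < t by rewrite lt_def t_neq0.
  have : (1 - t) * `|x - z| <= (1 - t) * r by rewrite ler_wpM2l ?subr_ge0// ltW.
  have : t * `|x - y| < t * r by rewrite ltr_pM2l.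
  lra.
have ds (t : R) : 0 <= t -> t <= 1 ->
    is_derive t 1 (q \o s) (\sum_i grad q (s t) 0 i * (y - z) 0 i).
  move=> t0 t1; have [Os _] := rP _ (sB _ t0 t1).
  apply: (@is_derive_comp_grad _ _ s (cst (y - z)) q t _ (dq _ Os)) => i.
  have -> : (fun t => s t 0 i) = (fun t => z 0 i + t * (y - z) 0 i).
    by apply/funext => u; rewrite /s !mxE.
  by apply: is_derive_eq; rewrite /cst /GRing.scale/=; ring.
have cqs : {within `[0, 1], continuous (q \o s)}.
  apply: derivable_within_continuous => t; rewrite in_itv/= => /andP[t0 t1].
  by case: (ds t t0 t1).
have [|t] := @MVT R (q \o s) (fun t => \sum_i grad q (s t) 0 i * (y - z) 0 i) 0 1 ltr01 _ cqs.
  by move=> t; rewrite in_itv/= => /andP[/ltW t0 /ltW t1]; exact: ds.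
rewrite in_itv/= => /andP[/ltW t0 /ltW t1].
rewrite /= /s scale1r scale0r addr0 subr0 mulr1 subrKC => ->.
have [_ Bs] := rP _ (sB _ t0 t1).
rewrite (le_trans (ler_norm_sum _ _ _))//.
apply: (@le_trans _ _ (\sum_i c i * `|y - z|)).
  apply: ler_sum => i _; rewrite normrM ler_pM// ?Bs//; exact: ler_coord_norm.
by rewrite -mulr_suml ler_wpM2r// lerDl.
Unshelve. all: by end_near. Qed.

(** [K] need not be convex, and segments between its points may leave [O]. Near a diagonal point of
    [K * K] the local estimate applies; near any other point the increment of [q] is bounded while
    the distance stays away from 0. Compactness of [K * K] makes the constant uniform. *)
Lemma C1_lipschitz_on_compact (K : set 'rV[R]_n) : compact K -> K `<=` O ->
  exists2 L : R, 0 < L & forall y z, K y -> K z -> `|q y - q z| <= L * `|y - z|.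
Proof.
move=> cK KO.
pose P (L : R) (z : 'rV[R]_n * 'rV[R]_n) := `|q z.1 - q z.2| <= L * `|z.1 - z.2|.
have nc := (compact_near_coveringP _).1 (compact_setX cK cK).
have : \forall L \near +oo, K `*` K `<=` P L.
  apply: nc => -[y0 z0] [/= Ky Kz].
  have [<-{z0 Kz}|yz] := eqVneq y0 z0.
    have [L L0 [r r0 Lr]] := C1_locally_lipschitz _ (KO _ Ky).
    have zB : \forall z \near (y0, y0), ball y0 r z.1 /\ ball y0 r z.2.
      by exists (ball y0 r, ball y0 r) => //=; split; exact: nbhsx_ballx.
    near=> z L1; rewrite /P.
    have [z1 z2] : ball y0 r z.1 /\ ball y0 r z.2 by near: z.
    have LL1 : L <= L1 by near: L1; apply: nbhs_pinfty_ge; exact: num_real.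
    by rewrite (le_trans (Lr _ _ z1 z2))// ler_wpM2r.
  have d0 : 0 < `|y0 - z0| / 2 by rewrite divr_gt0// normr_gt0 subr_eq0.
  have cq U : O U -> {for U, continuous q}.
    by move=> OU; apply: differentiable_continuous; exact: dq.
  have qB : \forall z \near (y0, z0), `|q z.1 - q z.2| <= `|q y0 - q z0| + 1.
    have : (q z.1 - q z.2) @[z --> (y0, z0)] --> q y0 - q z0.
      apply: cvgB.
        by apply: (@cvg_comp _ _ _ fst q _ (nbhs y0)); [exact: cvg_fst|exact: cq _ (KO _ Ky)].
      by apply: (@cvg_comp _ _ _ snd q _ (nbhs z0)); [exact: cvg_snd|exact: cq _ (KO _ Kz)].
    move=> /cvgrPdist_le /(_ 1 ltr01); apply: filterS => z; rewrite distrC => zB.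
    by rewrite -lerBlDl (le_trans (lerB_dist _ _)).
  have zB : \forall z \near (y0, z0), `|y0 - z0| / 2 <= `|z.1 - z.2|.
    have : (z.1 - z.2) @[z --> (y0, z0)] --> y0 - z0.
      by apply: cvgB; [exact: cvg_fst|exact: cvg_snd].
    move=> /cvgrPdist_le /(_ _ d0); apply: filterS => z zd.
    have := le_trans (lerB_dist _ _) zd; lra.
  near=> z L; rewrite /P.
  have qz : `|q z.1 - q z.2| <= `|q y0 - q z0| + 1 by near: z.
  have dz : `|y0 - z0| / 2 <= `|z.1 - z.2| by near: z.
  have Lz : (`|q y0 - q z0| + 1) / (`|y0 - z0| / 2) <= L.
    by near: L; apply: nbhs_pinfty_ge; exact: num_real.
  have L0 : 0 <= L by apply: le_trans Lz; rewrite divr_ge0 ?addr_ge0// ltW.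
  rewrite (le_trans qz)//; move: Lz; rewrite ler_pdivrMr// => Lz.
  by rewrite (le_trans Lz)// ler_wpM2l.
move=> [M [_ MP]]; exists (`|M| + 1); first by rewrite ltr_wpDl.
by move=> y z Ky Kz; apply: (MP (`|M| + 1) _ (y, z)) => //;
  rewrite (le_lt_trans (ler_norm M))// ltrDl.
Unshelve. all: by end_near. Qed.

End LipschitzOnCompact.

(** * Path integrals of gradients *)

Section PathIntegral.
Context {R : realType} (n : nat) (O : set 'rV[R]_n) (q : 'rV[R]_n -> R).
Notation leb := (@lebesgue_measure R).
Hypothesis openO : open O.
Hypothesis dq : forall U, O U -> differentiable q U.
Hypothesis cdq : forall U i, O U -> {for U, continuous (fun W => grad q W 0 i)}.

(** The path stays in a compact subset of [O], where [q] is Lipschitz. So [q] along the path is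
    Lipschitz, and is the integral of its almost everywhere derivative, computed by the chain
    rule. *)
Lemma path_integral_exact (B : 'rV[R]_n -> 'rV[R]_n)
    (phi : R -> 'rV[R]_n -> 'rV[R]_n -> 'rV[R]_n) (Vl Vr : 'rV[R]_n) :
  lipschitz_paths O phi -> (forall U, O U -> B U = grad q U) ->
  O Vl -> O Vr -> path_integral B phi Vl Vr = q Vr - q Vl.
Proof.
move=> lip BE Ol Or; have [phi0 phi1 phiO] := lip _ _ Ol Or.
move=> [M [_ MP]].
pose L := `|M| + 1.
have L0 : 0 < L by rewrite ltr_wpDl.
(* [c] clamps time to [[0, 1]]: [phi] is controlled only there, whereas [lipschitz_FTC] takes a
   function that is Lipschitz on the whole line. *)
pose c (t : R) := Num.max 0 (Num.min t 1).
have c01 t : 0 <= c t <= 1.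
  by rewrite /c le_max lexx ge_max ler01 ge_min lexx orbT.
have cE t : 0 <= t <= 1 -> c t = t.
  by move=> /andP[t0 t1]; rewrite /c (min_l t1) (max_r t0).
have clip s t : `|c s - c t| <= `|s - t|.
  have half u v : u <= v -> 0 <= c v - c u <= v - u.
    move=> uv; rewrite /c; case: (leP u 1) => u1; case: (leP v 1) => v1;
      rewrite ?(max_r ler01); case: (leP 0 u) => u0; case: (leP 0 v) => v0;
      apply/andP; split; lra.
  have [st|/ltW ts] := leP s t.
    have /andP[c1 c2] := half _ _ st.
    by rewrite distrC (distrC s) !ger0_norm// subr_ge0.
  have /andP[c1 c2] := half _ _ ts.
  by rewrite !ger0_norm// subr_ge0.
pose g (t : R) := phi (c t) Vl Vr.
have glip s t : `|g s - g t| <= L * `|s - t|.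
  have -> : g s - g t = phi (c s) Vl Vr - phi (c t) Vl Vr by [].
  have ML : M < L by rewrite (le_lt_trans (ler_norm M))// ltrDl.
  have := MP L ML (c s, c t) => /= /(_ _)/le_trans; apply.
    by split; rewrite /= in_itv/= c01.
  by rewrite ler_wpM2l// ltW.
have gO t : O (g t) by apply: phiO; rewrite in_itv/= c01.
have cg : continuous g.
  move=> t; apply/cvgrPdist_lt => e e0; near=> u.
  rewrite (le_lt_trans (glip _ _))// mulrC -ltr_pdivlMr//.
  by near: u; apply: cvgr_dist_lt; [exact: cvg_id|exact: divr_gt0].
pose K := g @` `[0, 1].
have cK : compact K.
  by apply: continuous_compact; [exact: continuous_subspaceT|exact: segment_compact].
have KO : K `<=` O by move=> _ [t _ <-].
have gK t : K (g t) by exists (c t); rewrite /= ?in_itv/= ?c01// /g cE.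
have [Lq Lq0 qlip] := C1_lipschitz_on_compact _ _ _ openO dq cdq K cK KO.
have qglip s t : `|(q \o g) s - (q \o g) t| <= (Lq * L) * `|s - t|.
  by rewrite (le_trans (qlip _ _ _ _))// -mulrA ler_wpM2l// ltW.
have gilip i s t : `|g s 0 i - g t 0 i| <= L * `|s - t|.
  apply: le_trans (glip s t).
  by have := ler_coord_norm _ (g s - g t) i; rewrite !mxE.
have [k [mk ik kE dk]] := lipschitz_FTC (Lq * L) (q \o g) 0 1 (mulr_gt0 Lq0 L0) qglip.
have /choice[h hP] i := lipschitz_FTC L (fun t => g t 0 i) 0 1 L0 (gilip i).
have g0 : g 0 = Vl by rewrite /g cE ?lexx ?ler01.
have g1 : g 1 = Vr by rewrite /g cE ?lexx ?ler01.
have -> : q Vr - q Vl = \int[leb]_(s in `]0, 1]) k s by rewrite kE ?lexx ?ler01//= g0 g1.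
rewrite Rintegral_itv_obnd_cbnd// /path_integral /Rintegral; congr fine.
apply: eq_integral_off_null.
have dh : {ae leb, forall s : R, forall i : 'I_n, 0 < s -> s < 1 ->
    is_derive s 1 (fun t => g t 0 i) (h i s)}.
  apply: (@filter_forall _ _ (fun (i : 'I_n) (s : R) => 0 < s -> s < 1 ->
    is_derive s 1 (fun t => g t 0 i) (h i s)) _ (ae_filter_ringOfSetsType leb)).
  by move=> i; have [] := hP i.
(* At the end points the derivative of [phi] may depend on times outside [[0, 1]], where [phi] may
   differ from [g]. *)
have ends : {ae leb, forall s : R, s != 0 /\ s != 1}.
  exists [set 0; 1]; split.
  - exact: measurableU (measurable_set1 _) (measurable_set1 _).
  - by apply: countable_lebesgue_measure0; apply: finite_set_countable; exact: finite_set2.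
  - move=> s /= /not_andP[] /negP; rewrite negbK => /eqP ->; [by left|by right].
have := @filterI _ _ (ae_filter_ringOfSetsType leb) _ _ dk
  (@filterI _ _ (ae_filter_ringOfSetsType leb) _ _ dh ends).
apply: (@filterS _ _ (ae_filter_ringOfSetsType leb)).
move=> s [dks [dhs [sn0 sn1]]] /=; rewrite in_itv/= => /andP[s0 s1].
have {}s0 : 0 < s by rewrite lt_def sn0.
have {}s1 : s < 1 by rewrite lt_def eq_sym sn1.
have gphi : \near s, g s = phi s Vl Vr.
  near=> t; rewrite /g cE//; apply/andP; split; apply: ltW; near: t.
    exact: lt_nbhsr.
  exact: lt_nbhsl.
have gs := nbhs_singleton gphi.
have derg : derivable g s 1.
  by apply/derivable_mxP => i j; rewrite ord1; case: (dhs j s0 s1).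
have dphi : derive1 (fun r => phi r Vl Vr) s = \row_i h i s.
  rewrite derive1E -(near_eq_derive _ gphi) derive_mx//.
  by apply/rowP => i; rewrite !mxE; exact: (@derive_val _ _ _ _ _ _ _ (dhs i s0 s1)).
congr (_%:E); rewrite dphi -gs BE//.
have := @is_derive_comp_grad _ _ g (fun t => \row_i h i t) q s.
move=> /(_ _ (dq _ (gO s))) dqg.
have <- := @derive_val _ _ _ _ _ _ _ (dks s0 s1).
apply/esym; apply: derive_val; apply: dqg => i; rewrite mxE; exact: dhs.
Unshelve. all: by end_near. Qed.

End PathIntegral.

(** * Uniqueness of the nonconservative product *)

Section ChargeUniqueness.
Context {R : realType}.
Notation leb := (@lebesgue_measure R).
Notation charge_on_line := (charge (measurableTypeR R) R).

(** The square removes the corner of the positive part at 0; this makes [bump] a [C^1] function. *)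
Lemma is_derive_pos_part_sqr (u : R) :
  is_derive u 1 (fun t : R => Num.max t 0 ^+ 2) (2 * Num.max u 0).
Proof.
have [u0|u0|->] := ltgtP u 0.
- rewrite mulr0.
  have d0 : is_derive u 1 (cst (0 : R)) 0 := is_derive_cst (0 : R) u 1.
  apply: (near_eq_is_derive _ d0).
  by near=> t; rewrite max_r ?expr0n//; apply: ltW; near: t; exact: lt_nbhsl.
- apply: (@near_eq_is_derive _ _ _ (fun t : R => t ^+ 2)).
    by near=> t; rewrite max_l//; apply: ltW; near: t; exact: lt_nbhsr.
  by apply: is_derive_eq; rewrite /GRing.scale/=; ring.
- rewrite mulr0.
  pose m2 (t : R) : R := Num.max t 0 ^+ 2.
  have lim0 : h^-1 *: (m2 (h *: (1 : R) + 0) - m2 0) @[h --> 0^'] --> (0 : R).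
    apply/cvgrPdist_le => e e0; near=> h.
    have h0 : h != 0 by near: h; exact: nbhs_dnbhs_neq.
    have he : `|h| <= e by near: h; apply: dnbhs0_le.
    rewrite sub0r normrN /m2 /GRing.scale/= mulr1 addr0 maxxx expr0n subr0.
    rewrite (le_trans _ he)//; case: (leP 0 h) => [_|h_lt0].
      by rewrite expr2 mulKf.
    by rewrite expr0n mulr0 normr0.
  split; first exact: (cvgP _ lim0).
  exact: (cvg_lim (@Rhausdorff R) lim0).
Unshelve. all: by end_near. Qed.

(* [nw / (1 + nw)], where the [C^1] function [w] is positive exactly on [`]a, b[],
   increases to the indicator of [`]a, b[]. *)
Definition bump (a b : R) (n : nat) (z : R) : R :=
  n%:R * Num.max ((z - a) * (b - z)) 0 ^+ 2 /
    (1 + n%:R * Num.max ((z - a) * (b - z)) 0 ^+ 2).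

Lemma bump_C1 (a b : R) n : a < b -> C1_compact_support (bump a b n).
Proof.
move=> ab; pose u (z : R) : R := (z - a) * (b - z).
pose w (z : R) : R := Num.max (u z) 0 ^+ 2.
pose dw (z : R) : R := 2 * Num.max (u z) 0 * (a + b - 2 * z).
have w0 z : 0 <= w z by exact: sqr_ge0.
have nw0 z : 1 + n%:R * w z != 0.
  by rewrite gt_eqF// ltr_pwDl// mulr_ge0.
have dwE (z : R) : is_derive z 1 w (dw z).
  have du : is_derive z 1 u (a + b - 2 * z).
    by apply: is_derive_eq; rewrite /GRing.scale/=; ring.
  have := @is_derive1_comp _ (fun t : R => Num.max t 0 ^+ 2) u z _ _ (is_derive_pos_part_sqr _) du.
  by [].
pose db (z : R) : R := n%:R * dw z / (1 + n%:R * w z) ^+ 2.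
have dbE (z : R) : is_derive z 1 (bump a b n) (db z).
  have d1 : is_derive z 1 (fun z : R => 1 + n%:R * w z : R) (n%:R * dw z).
    by apply: is_derive_eq; rewrite /GRing.scale/=; ring.
  have d2 := @is_deriveV R (fun z => 1 + n%:R * w z) z _ 1 (nw0 z) d1.
  have -> : bump a b n = (fun z => n%:R * w z * (1 + n%:R * w z)^-1) by [].
  apply: is_derive_eq; rewrite /GRing.scale/= /db; field; exact: nw0.
have cu : continuous u.
  by move=> z; apply: cvgM; [apply: cvgB; [exact: cvg_id|exact: cvg_cst]|
    apply: cvgB; [exact: cvg_cst|exact: cvg_id]].
have cm : continuous (fun z => Num.max (u z) 0).
  by move=> z; apply: (@continuous_max R R u (cst 0) z (cu z)); exact: cvg_cst.
have cw : continuous w by move=> z; exact: (cvgM (cm z) (cm z)).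
have db' : derive1 (bump a b n) = db.
  by apply/funext => z; rewrite derive1E; exact: (@derive_val _ _ _ _ _ _ _ (dbE z)).
split.
- by move=> z; case: (dbE z).
- rewrite db' => z; apply: cvgM.
    apply: cvgM; first exact: cvg_cst.
    apply: cvgM; first by apply: cvgM; [exact: cvg_cst|exact: cm].
    by apply: cvgB; [exact: cvg_cst|apply: cvgM; [exact: cvg_cst|exact: cvg_id]].
  apply: cvgV; first by rewrite expf_neq0.
  have c1 : 1 + n%:R * w t @[t --> z] --> 1 + n%:R * w z.
    by apply: cvgD; [exact: cvg_cst|apply: cvgM; [exact: cvg_cst|exact: cw]].
  exact: (cvgM c1 c1).
- apply: (subclosed_compact _ (@segment_compact _ a b)); first exact: closed_closure.
  have cl : closed (`[a, b]%classic : set R) by exact: interval_closed.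
  rewrite (iffLR (closure_id _) cl); apply: closure_subset => z /=.
  move=> bz0; rewrite in_itv/=; apply/negPn/negP => zab; move/negP: bz0; apply; apply/eqP.
  rewrite /bump -/(u z) -/(w z) /w max_r ?expr0n ?mulr0 ?mul0r//.
  rewrite /u; move: zab; rewrite negb_and -!ltNge => /orP[za|bz].
    by rewrite mulr_le0_ge0 ?subr_le0 ?subr_ge0// ?ltW// (lt_trans za).
  by rewrite mulr_ge0_le0 ?subr_le0 ?subr_ge0// ?ltW// (lt_trans ab).
Qed.

Lemma bump_ge0 a b n z : 0 <= bump a b n z.
Proof.
have w0 : 0 <= n%:R * Num.max ((z - a) * (b - z)) 0 ^+ 2 by apply: mulr_ge0 => //; exact: sqr_ge0.
by apply: divr_ge0 => //; exact: addr_ge0.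
Qed.

Lemma bump_le1 a b n z : bump a b n z <= 1.
Proof.
have w0 : 0 <= n%:R * Num.max ((z - a) * (b - z)) 0 ^+ 2 by apply: mulr_ge0 => //; exact: sqr_ge0.
by rewrite /bump ler_pdivrMr ?ltr_pwDl// mul1r lerDr.
Qed.

Lemma bump_cvg (a b z : R) : a < b ->
  bump a b n z @[n --> \oo] --> (\1_(`]a, b[%classic : set R) z : R).
Proof.
move=> ab; rewrite indicE; have [|zab] := boolP (z \in (`]a, b[%classic : set R)).
  rewrite inE/= in_itv/= => /andP[az zb].
  pose w := Num.max ((z - a) * (b - z)) 0 ^+ 2.
  have w0 : 0 < w.
    have u0 : 0 < (z - a) * (b - z) by rewrite mulr_gt0// subr_gt0.
    by rewrite /w max_l ?exprn_gt0// ltW.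
  apply/cvgrPdist_le => e e0; near=> n.
  have nw0 : 0 <= n%:R * w by rewrite mulr_ge0// ltW.
  have -> : 1 - bump a b n z = (1 + n%:R * w)^-1.
    by rewrite /bump -/w; field; rewrite gt_eqF// ltr_pwDl.
  rewrite ger0_norm ?invr_ge0 ?addr_ge0// -[leRHS]invrK lef_pV2 ?posrE ?invr_gt0 ?ltr_pwDl//.
  have : e^-1 / w <= n%:R by near: n; exact: nbhs_infty_ger.
  by rewrite ler_pdivrMr//; lra.
rewrite (_ : (fun n => bump a b n z) = cst 0); first exact: cvg_cst.
apply/funext => n; rewrite /bump max_r ?expr0n ?mulr0 ?mul0r//.
move: zab; rewrite notin_setE/= in_itv/= => /negP; rewrite negb_and -!leNgt => /orP[za|bz].
  by rewrite mulr_le0_ge0 ?subr_le0 ?subr_ge0// (le_trans za)// ltW.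
by rewrite mulr_ge0_le0 ?subr_le0 ?subr_ge0// (le_trans _ bz)// ltW.
Unshelve. all: by end_near. Qed.

Lemma measurable_bump a b n : a < b -> measurable_fun setT (bump a b n).
Proof.
move=> ab; apply: continuous_measurable_fun => x.
by apply/differentiable_continuous/derivable1_diffP; case: (bump_C1 a b n ab).
Qed.

Lemma charge_decomposition (nu : charge_on_line) :
  exists mp mn : {finite_measure set (measurableTypeR R) -> \bar R},
    forall A, measurable A -> (nu A = mp A - mn A)%E.
Proof.
have [P [N PN]] := Hahn_decomposition nu.
exists (jordan_pos PN), (jordan_neg PN) => A mA.
by rewrite (jordan_decomp PN mA) /cadd/= cscaleN1.
Qed.

Lemma integral_bump_cvg (m : {finite_measure set (measurableTypeR R) -> \bar R}) (a b : R) :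
  a < b -> \int[m]_z bump a b n z @[n --> \oo] --> fine (m `]a, b[%classic).
Proof.
move=> ab; have mI : measurable (`]a, b[%classic : set (measurableTypeR R)).
  exact: measurable_itv.
have [|||||_ _] := @dominated_convergence _ (measurableTypeR R) R m setT measurableT
  (fun n z => (bump a b n z)%:E) (fun z => (\1_(`]a, b[%classic : set R) z)%:E) (cst 1%E).
- by move=> n; apply/measurable_EFinP; exact: measurable_bump.
- by apply/measurable_EFinP; exact: measurable_indic.
- by apply: aeW => z _; apply: cvg_EFin; [exact: nearW|exact: bump_cvg].
- exact: finite_measure_integrable_cst.
- by apply: aeW => z n _; rewrite lee_fin ger0_norm ?bump_ge0// bump_le1.
rewrite integral_indic// setIT -[X in _ --> X -> _]fineK ?fin_num_measure// => lim1.
exact: (fine_cvg lim1).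
Qed.

Lemma charge_integral_ext (nu nu' : charge_on_line) (E : set R) (f : R -> R) :
  (forall A : set R, measurable A -> nu A = nu' A) ->
  measurable_fun setT f -> (exists C, forall x, `|f x| <= C) -> measurable E ->
  charge_integral nu E f = charge_integral nu' E f.
Proof.
move=> nunu' mf bf mE; have [mp [mn nuE]] := charge_decomposition nu.
rewrite (charge_integralE nu mp mn)// (charge_integralE nu' mp mn)// => A mA.
by rewrite -nunu'// nuE.
Qed.

(** Bumps recover the charge of each open interval by dominated convergence. Open intervals are
    stable under intersection, but uniqueness from such a class holds for positive measures:
    equality of [a - b] and [a' - b'] is therefore rewritten as equality of [a + b'] and
    [a' + b]. *)
Lemma charge_unique_C1 (nu nu' : charge_on_line) :
  (forall theta, C1_compact_support theta ->
    charge_integral nu setT theta = charge_integral nu' setT theta) ->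
  forall A : set R, measurable A -> nu A = nu' A.
Proof.
move=> nunu'.
have [a [b nuE]] := charge_decomposition nu.
have [a' [b' nuE']] := charge_decomposition nu'.
have finm (m : {finite_measure set (measurableTypeR R) -> \bar R}) A :
  measurable A -> m A \is a fin_num by move=> mA; exact: fin_num_measure.
have key (x y z w : \bar R) : x \is a fin_num -> y \is a fin_num ->
    z \is a fin_num -> w \is a fin_num -> (x + w = z + y)%E <-> (x - y = z - w)%E.
  case: x y z w => [x| |] // [y| |] // [z| |] // [w| |] // _ _ _ _.
  by rewrite -!EFinB -!EFinD; split=> -[] ?; congr (_%:E); lra.
have oo_eq (x y : R) : (a `]x, y[%classic + b' `]x, y[%classic =
                        a' `]x, y[%classic + b `]x, y[%classic)%E.
  have [xy|yx] := ltP x y; last first.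
    by rewrite set_itv_ge ?measure0// -leNgt bnd_simp.
  have mI : measurable (`]x, y[%classic : set (measurableTypeR R)) by exact: measurable_itv.
  apply/key; [exact: finm..|].
  suff : fine (a `]x, y[%classic) - fine (b `]x, y[%classic) =
      fine (a' `]x, y[%classic) - fine (b' `]x, y[%classic).
    move=> eqI.
    rewrite -(fineK (finm a _ mI)) -(fineK (finm b _ mI)).
    by rewrite -(fineK (finm a' _ mI)) -(fineK (finm b' _ mI)) -!EFinB eqI.
  have c1 : charge_integral nu setT (bump x y n) @[n --> \oo] -->
      fine (a `]x, y[%classic) - fine (b `]x, y[%classic).
    have E n : charge_integral nu setT (bump x y n) = \int[a]_z bump x y n z - \int[b]_z bump x y n z.
      apply: charge_integralE => //; first exact: measurable_bump.
      by exists 1 => z; rewrite ger0_norm ?bump_ge0// bump_le1.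
    by rewrite (funext E); apply: cvgB; exact: integral_bump_cvg.
  have c2 : charge_integral nu setT (bump x y n) @[n --> \oo] -->
      fine (a' `]x, y[%classic) - fine (b' `]x, y[%classic).
    have E n : charge_integral nu setT (bump x y n) = \int[a']_z bump x y n z - \int[b']_z bump x y n z.
      rewrite nunu'; last exact: bump_C1.
      apply: charge_integralE => //; first exact: measurable_bump.
      by exists 1 => z; rewrite ger0_norm ?bump_ge0// bump_le1.
    by rewrite (funext E); apply: cvgB; exact: integral_bump_cvg.
  exact: (cvg_unique (@Rhausdorff R) c1 c2).
move=> A mA; rewrite nuE// nuE'//.
apply: (iffLR (key _ _ _ _ (finm a _ mA) (finm b _ mA) (finm a' _ mA) (finm b' _ mA))).
rewrite -(measure_addE a b') -(measure_addE a' b).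
apply: (@measure_unique _ R (measurableTypeR R) (@RGenOpens.G R)
  (fun k => `]- k%:R, k%:R[%classic) _ _ _ _ (measure_add a b') (measure_add a' b)) => //.
- exact: RGenOpens.measurableE.
- move=> _ _ [x1 [y1 ->]] [x2 [y2 ->]]; exists (Num.max x1 x2), (Num.min y1 y2).
  apply/seteqP; split => z /=; rewrite !in_itv/= gt_max lt_min.
    by move=> [/andP[-> ->] /andP[-> ->]].
  by move=> /andP[/andP[-> ->] /andP[-> ->]].
- by move=> k; exists (- k%:R), k%:R.
- apply/seteqP; split => // z _; exists (Num.truncn `|z|).+1 => //=.
  by rewrite in_itv/= -ltr_norml Num.Theory.truncnS_gt.
- by move=> _ [x [y ->]]; rewrite [LHS](measure_addE a b') [RHS](measure_addE a' b); exact: oo_eq.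
- move=> k; rewrite [ltLHS](measure_addE a b').
  have mI : measurable (`]- k%:R, k%:R[%classic : set (measurableTypeR R)) by exact: measurable_itv.
  by rewrite lte_add_pinfty// -ge0_fin_numE//; exact: finm.
Qed.

End ChargeUniqueness.

Section MeasurableComposition.
Context {R : realType}.

Lemma measurable_comp_continuous_on d (X : measurableType d) (D : set X) n
    (O : set 'rV[R]_n) (f : 'rV[R]_n -> R) (U : X -> 'rV[R]_n) :
  measurable D -> (forall W, O W -> {for W, continuous f}) ->
  (forall x, D x -> O (U x)) -> (forall i, measurable_fun D (fun x => U x 0 i)) ->
  measurable_fun D (f \o U).
Proof.
move=> mD cf UO mU.
apply: (measurability (@RGenOInfty.G R)) => [|/= _ [_] [r] -> <-].
  exact: RGenOInfty.measurableE.
pose box (c : 'rV[rat]_n) (k : nat) : set X :=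
  D `&` [set x | forall i, `|ratr (c 0 i) - U x 0 i| < k.+1%:R^-1].
pose good (ck : 'rV[rat]_n * nat) :=
  forall W : 'rV[R]_n, (forall i, `|ratr (ck.1 0 i) - W 0 i| < ck.2.+1%:R^-1) -> r < f W.
have -> : D `&` (f \o U) @^-1` `]r, +oo[ =
    \bigcup_ck (if `[< good ck >] then box ck.1 ck.2 else set0).
  apply/seteqP; split => [x [Dx]|x [[c k] _]]; last first.
    case: asboolP => // gck [Dx xck]; split => //=.
    by rewrite in_itv/= andbT; exact: gck.
  rewrite /= in_itv/= andbT => rfx.
  have /nbhs_ballP[e /= e0 eP] : \forall W \near U x, r < f W.
    exact: (cvgr_gt (f (U x)) (cf _ (UO _ Dx)) r rfx).
  (* The factor 2 pays for the distance from [U x] to a rational centre and from that centre to a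
     point of the box. *)
  have [k ke] : exists k : nat, 2 * k.+1%:R^-1 < e.
    exists (Num.truncn (2 / e)); rewrite ltr_pdivrMr// mulrC -ltr_pdivrMr//.
    exact: Num.Theory.truncnS_gt.
  have /choice[c cP] i : exists q : rat, `|ratr q - U x 0 i| < k.+1%:R^-1.
    have k0 : 0 < k.+1%:R^-1 :> R by rewrite invr_gt0.
    have /rat_in_itvoo[q] : U x 0 i - k.+1%:R^-1 < U x 0 i + k.+1%:R^-1.
      by rewrite ltrD2l (lt_trans _ k0)// oppr_lt0.
    by rewrite in_itv/= => qU; exists q; rewrite ltr_distl.
  exists (\row_i c i, k) => //; rewrite ifT.
    by split => //= i; rewrite mxE.
  apply/asboolP => W /= WB; apply: eP; rewrite -ball_normE/=.
  apply: le_lt_trans ke; apply: rV_norm_le => [|i]; first by rewrite mulr_ge0.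
  rewrite !mxE; have := WB i; rewrite mxE => WBi.
  have -> : U x 0 i - W 0 i = (U x 0 i - ratr (c i)) + (ratr (c i) - W 0 i) by ring.
  by rewrite (le_trans (ler_normD _ _))// distrC mulr_natl mulr2n lerD// ltW.
apply: countable_bigcupT_measurable => // -[c k] /=.
case: asboolP => // _; rewrite /box.
have -> : D `&` [set x | forall i, `|ratr (c 0 i) - U x 0 i| < k.+1%:R^-1] =
    D `&` \bigcap_(i in [set: 'I_n]) (D `&` [set x | `|ratr (c 0 i) - U x 0 i| < k.+1%:R^-1]).
  apply/seteqP; split => x [Dx xi]; split => //; first by move=> i _; split => //; exact: xi.
  by move=> i; have [] := xi i.
apply: measurableI => //; apply: fin_bigcap_measurable => //.
move=> i _.
have mi : measurable_fun D (fun x => `|ratr (c 0 i) - U x 0 i|).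
  by apply: measurableT_comp => //; exact: measurable_funB.
have := mi mD _ (measurable_itv `]-oo, k.+1%:R^-1[).
by congr measurable; apply/seteqP; split => x [Dx] /=; rewrite in_itv.
Qed.

Lemma cvg_rV n (T : Type) (F : set_system T) (f : T -> 'rV[R]_n) (l : 'rV[R]_n) :
  Filter F -> (forall i, f x 0 i @[x --> F] --> l 0 i) -> f x @[x --> F] --> l.
Proof.
move=> FF fl; apply/cvgrPdist_le => e e0.
have : \forall x \near F, forall i, `|l 0 i - f x 0 i| <= e.
  by apply: filter_forall => i; move/cvgrPdist_le : (fl i); apply.
by apply: filterS => x xe; apply: rV_norm_le => [|i]; [exact: ltW|rewrite !mxE; exact: xe].
Qed.


End MeasurableComposition.

(** * One-sided limits and discontinuities of BV functions *)

Section BVLimits.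
Context {R : realType}.

(** Jordan decomposition: each coordinate of [V] is the difference of the nondecreasing functions
    [W] and [W - V_i]. *)
Lemma BV_one_sided_limits n (V : R -> 'rV[R]_n) (x : R) : BV V ->
  (exists Vl : 'rV[R]_n, V y @[y --> x^'-] --> Vl) /\ (exists Vr : 'rV[R]_n, V y @[y --> x^'+] --> Vr).
Proof.
move=> BVV; have [M [W [ndW _ WV _]]] := BV_parametrization _ V BVV.
have ndWV i : {homo (fun y => W y - V y 0 i) : y z / y <= z}.
  by move=> y z yz; have := WV i _ _ yz; rewrite ler_norml; lra.
have VE i : (fun y => V y 0 i) = (fun y => W y - (W y - V y 0 i)).
  by apply/funext => y; rewrite opprB addrC subrK.
split.
- exists (\row_i (sup (W @` `]-oo, x[) - sup ((fun y => W y - V y 0 i) @` `]-oo, x[))).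
  apply: cvg_rV => i; rewrite mxE [in X in X --> _]VE.
  by apply: cvgB; exact: nondecreasing_cvg_at_left.
- exists (\row_i (inf (W @` `]x, +oo[) - inf ((fun y => W y - V y 0 i) @` `]x, +oo[))).
  apply: cvg_rV => i; rewrite mxE [in X in X --> _]VE.
  by apply: cvgB; [exact: nondecreasing_cvg_at_right|
    exact: (@nondecreasing_cvg_at_right _ (fun y => W y - V y 0 i))].
Qed.

(** Increments of [V] are bounded by those of [W], so [V] is continuous wherever the monotone [W]
    is; the line is exhausted by the intervals []-k, k[]. *)
Lemma BV_discontinuities_countable n (V : R -> 'rV[R]_n) : BV V ->
  countable [set x | ~ {for x, continuous V}].
Proof.
move=> BVV; have [M [W [ndW _ WV _]]] := BV_parametrization _ V BVV.
apply: (@sub_countable _ _ _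
  (\bigcup_k [set x | (x \in `]- k%:R, k%:R[) /\ discontinuity W x])); last first.
  by apply: bigcup_countable => // k _; apply: discontinuity_countable => y z _ _; exact: ndW.
apply: subset_card_le => x Vx.
have Wl := nondecreasing_cvg_at_left W x ndW.
have Wr := nondecreasing_cvg_at_right W x ndW.
exists (Num.truncn `|x|).+1 => //=; split.
  by rewrite in_itv/= -ltr_norml Num.Theory.truncnS_gt.
split; [exact: (cvgP _ Wl)|exact: (cvgP _ Wr)|].
apply/eqP => lim_eq; apply: Vx.
have lW : lim (W y @[y --> x^'-]) <= W x.
  apply: limr_le; first exact: (cvgP _ Wl).
  by near=> y; apply: ndW; near: y; exact: nbhs_left_le.
have rW : W x <= lim (W y @[y --> x^'+]).
  apply: limr_ge; first exact: (cvgP _ Wr).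
  by near=> y; apply: ndW; near: y; exact: nbhs_right_ge.
have cW : {for x, continuous W}.
  apply/left_right_continuousP; split.
    have -> : W x = lim (W y @[y --> x^'-]) by apply/le_anti; rewrite lW lim_eq rW.
    by apply: cvgP; exact: Wl.
  have -> : W x = lim (W y @[y --> x^'+]) by apply/le_anti; rewrite rW -lim_eq lW.
  by apply: cvgP; exact: Wr.
apply/cvgrPdist_le => e e0; move/cvgrPdist_le : cW => /(_ e e0).
apply: filterS => y Wxy; apply: le_trans Wxy.
apply: rV_norm_le => // i; rewrite !mxE.
have [xy|/ltW yx] := leP x y.
  by rewrite distrC (distrC (W x)) (le_trans (WV i _ _ xy))// ler_norm.
by rewrite (le_trans (WV i _ _ yx))// ler_norm.
Unshelve. all: by end_near. Qed.

End BVLimits.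

(** * Existence and uniqueness of the nonconservative product for a gradient *)

Section ExactProduct.
Context {R : realType}.
Notation leb := (@lebesgue_measure R).
Notation charge_on_line := (charge (measurableTypeR R) R).

(** An injection into the naturals splits [A] into sets [F k], each empty or a single point, whose
    masses are summed by sigma-additivity. *)
Lemma charge_countable_ext (nu nu' : charge_on_line) (A : set R) : countable A ->
  (forall x, A x -> nu [set x] = nu' [set x]) -> nu A = nu' A.
Proof.
move=> /countable_injP[f finj] nunu'.
pose F (k : nat) : set (measurableTypeR R) := [set x | A x /\ f x = k].
have Fcase k : F k = set0 \/ exists2 x, A x & F k = [set x].
  have [[x [Ax fx]]|Fk0] := pselect (exists x, A x /\ f x = k); last first.
    by left; rewrite -subset0 => x Fx; apply: Fk0; exists x.
  right; exists x => //; apply/seteqP; split => [y [Ay fy]|_ -> //].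
  by apply: finj; rewrite ?inE// fy fx.
have mF k : measurable (F k).
  by case: (Fcase k) => [->|[x _ ->]]; [exact: measurable0|exact: measurable_set1].
have tF : trivIset setT F.
  by apply/trivIsetP => i j _ _ ij; rewrite -subset0 => x [[_ fi] [_ fj]]; move: ij; rewrite -fi fj eqxx.
have UF : \bigcup_k F k = A.
  by apply/seteqP; split => [x [k _ []]//|x Ax]; exists (f x).
have mUF : measurable (\bigcup_k F k) by exact: bigcupT_measurable.
have c1 := @charge_semi_sigma_additive _ _ _ nu F mF tF mUF.
have c2 := @charge_semi_sigma_additive _ _ _ nu' F mF tF mUF.
have eqs : (fun n => \sum_(0 <= i < n) nu (F i))%E = (fun n => \sum_(0 <= i < n) nu' (F i))%E.
  apply/funext => k; apply: eq_bigr => i _.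
  by case: (Fcase i) => [->|[x Ax ->]]; rewrite ?charge0// nunu'.
rewrite eqs in c1; rewrite -UF; exact: (cvg_unique (@ereal_hausdorff R) c1 c2).
Qed.

Lemma BV_measurable n (V : R -> 'rV[R]_n) i : BV V -> measurable_fun setT (fun x => V x 0 i).
Proof.
move=> BVV; have [M [W [ndW _ WV _]]] := BV_parametrization _ V BVV.
have -> : (fun y => V y 0 i) = (fun y => W y - (W y - V y 0 i)).
  by apply/funext => y; rewrite opprB addrC subrK.
apply: measurable_funB; apply: nondecreasing_measurable => //.
by move=> y z yz; have := WV i _ _ yz; rewrite ler_norml; lra.
Qed.

Variables (n : nat) (O : set 'rV[R]_n) (q : 'rV[R]_n -> R) (B : 'rV[R]_n -> 'rV[R]_n).
Hypothesis openO : open O.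
Hypothesis dq : forall U, O U -> differentiable q U.
Hypothesis cdq : forall U i, O U -> {for U, continuous (fun W => grad q W 0 i)}.
Hypothesis BE : forall U, O U -> B U = grad q U.

Lemma grad_bounded_on_compact (K : set 'rV[R]_n) : compact K -> K `<=` O ->
  exists C, forall U i, K U -> `|grad q U 0 i| <= C.
Proof.
move=> cK KO.
have /choice[C CP] i : exists C, forall U, K U -> `|grad q U 0 i| <= C.
  have ci : {within K, continuous (fun U => grad q U 0 i)}.
    by apply: continuous_in_subspaceT => U; rewrite inE => /KO; exact: cdq.
  have [C _ CP] := compact_norm_bound _ _ (continuous_compact ci cK).
  by exists C => U KU; apply: CP; exists U.
exists (\sum_i `|C i|) => U i KU; rewrite (le_trans (CP i _ KU))// (le_trans (ler_norm _))//.
by rewrite (bigD1 i)//= lerDl sumr_ge0.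
Qed.

(** The derivative of [q o V] has the required form on continuity points by the chain rule, and the
    required point masses because the path integral is the jump of [q]. Conversely, each coordinate
    derivative is unique, which fixes any product off the countable discontinuity set, and point
    masses fix it on that set. *)
Lemma nonconservative_product_exact phi (V : R -> 'rV[R]_n) :
  lipschitz_paths O phi -> BV_state O V ->
  exists mu : charge_on_line, [/\ is_nonconservative_product B phi V mu,
    distributional_derivative (q \o V) mu &
    forall mu' : charge_on_line, is_nonconservative_product B phi V mu' ->
      forall E : set R, measurable E -> mu' E = mu E].
Proof.
move=> lip [BVV [K [cK KO KV]]].
have [L L0 qL] := C1_lipschitz_on_compact _ _ _ openO dq cdq K cK KO.
have [C CP] := grad_bounded_on_compact K cK KO.
have mB i : measurable_fun setT (fun x => grad q (V x) 0 i).
  apply: (@measurable_comp_continuous_on _ _ _ _ _ O (fun U => grad q U 0 i) V) => //.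
  - by move=> W; exact: cdq.
  - by move=> x _; exact/KO/KV.
  - by move=> j; exact: BV_measurable.
have BC i x : `|grad q (V x) 0 i| <= C by exact: CP.
have dqK U : K U -> differentiable q U by move=> /KO; exact: dq.
have [nu [mu [dnu dmu chain jump]]] := BV_chain_rule _ V K q L C BVV KV L0 qL dqK mB BC.
have Bi i : (fun x => B (V x) 0 i) = (fun x => grad q (V x) 0 i).
  by apply/funext => x; rewrite BE//; exact/KO/KV.
have ncp : is_nonconservative_product B phi V mu.
  exists nu => //; split.
    move=> E mE EC; rewrite chain//; congr (_%:E).
    by apply: eq_bigr => i _; rewrite Bi.
  move=> x Vl Vr _ Vxl Vxr.
  (* Closedness of [K] makes the one-sided limits states, so the path between them is admissible. *)
  have clK : closed K by apply: compact_closed => //; exact: norm_hausdorff.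
  have Kl : K Vl by apply: (closed_cvg _ clK _ _ Vxl); exact: nearW.
  have Kr : K Vr by apply: (closed_cvg _ clK _ _ Vxr); exact: nearW.
  rewrite (path_integral_exact n O q openO dq cdq B phi Vl Vr lip BE (KO _ Kl) (KO _ Kr)).
  apply: jump.
    exact: (cvg_comp V q Vxl (differentiable_continuous (dqK _ Kl))).
  exact: (cvg_comp V q Vxr (differentiable_continuous (dqK _ Kr))).
exists mu; split=> // mu' [nu' dnu' [mu'C mu'J]] E mE.
have nunu' i (A : set R) : measurable A -> nu' i A = nu i A.
  by apply: charge_unique_C1 => theta t1; rewrite dnu'// dnu.
have [nu0 dnu0 [muC muJ]] := ncp.
have nunu0 i (A : set R) : measurable A -> nu' i A = nu0 i A.
  by apply: charge_unique_C1 => theta t1; rewrite dnu'// dnu0.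
pose J := [set x | ~ {for x, continuous V}].
have cJ : countable J by exact: BV_discontinuities_countable.
have mJ : measurable (J : set (measurableTypeR R)).
  by apply: countable_measurable => //; exact: measurable_set1.
rewrite (chargeDI mu' mE mJ) (chargeDI mu mE mJ); congr (_ + _)%E.
  have mEJ : measurable (E `\` J) by exact: measurableD.
  have EJ : E `\` J `<=` [set x | {for x, continuous V}].
    by move=> x [_ /= /contrapT].
  rewrite mu'C// muC//; congr (_%:E); apply: eq_bigr => i _.
  apply: charge_integral_ext => //; rewrite ?Bi//; first exact: nunu0.
  by exists C => x; rewrite BE ?BC//; exact/KO/KV.
apply: charge_countable_ext.
  by apply: sub_countable cJ; apply: subset_card_le => x [].
move=> x [_ /= Jx].
have [[Vl Vxl] [Vr Vxr]] := BV_one_sided_limits _ V x BVV.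
by rewrite (mu'J _ _ _ Jx Vxl Vxr) (muJ _ _ _ Jx Vxl Vxr).
Qed.

End ExactProduct.

(** * Equivalence of the entropy inequalities *)

Section TestFunctionsPlane.
Context {R : realType}.
Notation leb := (@lebesgue_measure R).

Lemma smooth_derive_continuous (theta : R * R -> R) (b : bool) :
  smooth_on setT theta -> continuous ('D_(if b then dir1 else dir2) theta).
Proof.
move=> th z; apply: differentiable_continuous.
by have := th [:: b] z I; case: b.
Qed.

(** Measurability here refers to the product sigma-algebra; passing through row vectors of length 2,
    it reduces to that of the two projections. *)
Lemma measurable_continuous_plane (f : R * R -> R) : continuous f -> measurable_fun setT f.
Proof.
move=> cf; pose U (z : R * R) : 'rV[R]_2 := \row_i (if i == 0 then z.1 else z.2).
pose g (W : 'rV[R]_2) := f (W 0 0, W 0 1).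
have -> : f = g \o U by apply/funext => -[x y]; rewrite /g /U/= !mxE.
apply: (@measurable_comp_continuous_on _ _ _ _ _ setT) => //.
- move=> W _; apply: (@cvg_comp _ _ _ (fun W : 'rV[R]_2 => (W 0 0, W 0 1)) f _ _ _ _ (cf _)).
  have c0 : (fun W : 'rV[R]_2 => W 0 0) @ W --> W 0 0 by exact: coord_continuous.
  have c1 : (fun W : 'rV[R]_2 => W 0 1) @ W --> W 0 1 by exact: coord_continuous.
  exact: cvg_pair c0 c1.
- move=> i; rewrite /U; under eq_fun do rewrite mxE.
  by case: (i == 0); [exact: measurable_fst|exact: measurable_snd].
Qed.

Lemma is_derive_slice (theta : R * R -> R) (t x : R) : differentiable theta (t, x) ->
  is_derive x 1 (fun y => theta (t, y)) ('D_dir2 theta (t, x)).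
Proof.
move=> dth; have := @diff_derivable _ _ _ theta (t, x) dir2 dth.
have E : (fun h : R => h^-1 *: (theta (h *: dir2 + (t, x)) - theta (t, x))) =
    (fun h => h^-1 *: (theta (t, h *: 1 + x) - theta (t, x))).
  apply/funext => h; congr (_ *: (theta _ - _)).
  by rewrite /dir2; congr pair; rewrite /= /GRing.scale/= ?mulr0 ?add0r.
rewrite /derivable /derive E => dd; split => //.
Qed.

(** The lower bound on time is a compactness argument: [1 / t] is continuous on the support, hence
    bounded by some [C], and [t1 = 1 / C]. The norm bound [B] serves for both times and
    positions. *)
Lemma test_function_support (theta : R * R -> R) : nonneg_test_function theta ->
  exists t1 t2 B : R, [/\ 0 < t1, 0 < B &
    forall z, closure [set z | theta z != 0] z -> [/\ t1 <= z.1, z.1 <= t2 & `|z.2| <= B]].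
Proof.
move=> [_ _ cS Sh]; set S := closure _ in cS Sh *.
have [B B0 SB] := compact_norm_bound _ _ cS.
have ci : {within S, continuous (fun z : R * R => z.1^-1)}.
  apply: continuous_in_subspaceT => z; rewrite inE => /Sh /= z0.
  by apply: cvgV; [rewrite gt_eqF|exact: cvg_fst].
have [C C0 SC] := compact_norm_bound _ _ (continuous_compact ci cS).
exists C^-1, B, B; split=> [|//|z Sz]; first by rewrite invr_gt0.
have z0 : 0 < z.1 by exact: Sh.
have [z1B z2B] : `|z.1| <= B /\ `|z.2| <= B.
  by have := SB _ Sz; rewrite prod_normE ge_max => /andP[].
split=> //; last by rewrite (le_trans (ler_norm _)).
have := SC z.1^-1 (ex_intro2 _ _ z Sz erefl).
rewrite gtr0_norm ?invr_gt0// => zC.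
by rewrite -[leRHS]invrK lef_pV2 ?posrE ?invr_gt0.
Qed.

Lemma derive_off_support (theta : R * R -> R) v z :
  ~ closure [set z | theta z != 0] z -> 'D_v theta z = 0.
Proof.
move=> /near0_notin_support tz.
by rewrite (near_eq_derive (g := cst 0))// derive_cst.
Qed.

Lemma slice_C1 (theta : R * R -> R) (t : R) : nonneg_test_function theta ->
  C1_compact_support (fun x => theta (t, x)) /\
  derive1 (fun x => theta (t, x)) = (fun x => 'D_dir2 theta (t, x)).
Proof.
move=> th; have [t1 [t2 [B [_ _ SB]]]] := test_function_support _ th.
have [sm _ cS _] := th.
have dth z : differentiable theta z by exact: (sm [::] z I).
have dE : derive1 (fun x => theta (t, x)) = (fun x => 'D_dir2 theta (t, x)).
  apply/funext => x; rewrite derive1E.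
  exact: (@derive_val _ _ _ _ _ _ _ (is_derive_slice _ _ _ (dth _))).
split=> //; split.
- by move=> x; case: (is_derive_slice _ _ _ (dth (t, x))).
- rewrite dE => x.
  apply: (@cvg_comp _ _ _ (fun x => (t, x)) ('D_dir2 theta) _ _ _ _ (smooth_derive_continuous _ false sm _)).
  have c0 : (fun _ : R => t) @ x --> t by exact: cvg_cst.
  have c1 : (fun y : R => y) @ x --> x by exact: cvg_id.
  exact: cvg_pair c0 c1.
- apply: (subclosed_compact _ (@segment_compact _ (- B) B)); first exact: closed_closure.
  have cl : closed (`[- B, B]%classic : set R) by exact: interval_closed.
  rewrite (iffLR (closure_id _) cl); apply: closure_subset => x /= tx.
  rewrite in_itv/= -ler_norml.
  have Stx : closure [set z | theta z != 0] (t, x) by exact: subset_closure.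
  by have [_ _ +] := SB _ Stx.
Qed.

End TestFunctionsPlane.

Section InequalityEquivalence.
Context {R : realType}.
Notation leb := (@lebesgue_measure R).
Notation charge_on_line := (charge (measurableTypeR R) R).
Variables (n : nat) (O : set 'rV[R]_n) (A : 'rV[R]_n -> 'M[R]_n).
Variables (eta q : 'rV[R]_n -> R).
Hypothesis openO : open O.
Hypothesis ceta : forall U, O U -> {for U, continuous eta}.
Hypothesis dq : forall U, O U -> differentiable q U.
Hypothesis cdq : forall U i, O U -> {for U, continuous (fun W => grad q W 0 i)}.
Hypothesis compat : forall U, O U -> grad eta U *m A U = grad q U.

Lemma measurable_half_plane :
  measurable (@half_plane R : set (measurableTypeR R * measurableTypeR R)).
Proof.
have -> : @half_plane R = setT `&` fst @^-1` `]0, +oo[%classic.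
  by apply/seteqP; split => z /=; rewrite ?in_itv/= ?andbT //; case.
by apply: measurable_fst => //; exact: measurable_itv.
Qed.

(** On the support of [theta], time stays in [[t1, t2]] and [U] in a compact set of states, so [F]
    is dominated by a constant times the indicator of a rectangle; a product bound controls every
    slice as well. *)
Lemma field_test_integrable (f : 'rV[R]_n -> R) (U : R -> R -> 'rV[R]_n)
    (theta : R * R -> R) (b : bool) :
  (forall W, O W -> {for W, continuous f}) -> BV_field O U -> nonneg_test_function theta ->
  let F := (fun z => f (U z.1 z.2) * 'D_(if b then dir1 else dir2) theta z) \_ half_plane in
  [/\ (leb \x leb)%E.-integrable setT (EFin \o F),
    forall t, leb.-integrable setT (fun x => (F (t, x))%:E) &
    forall x, leb.-integrable setT (fun t => (F (t, x))%:E)].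
Proof.
move=> cf [mU BVU KU] th F.
have [t1 [t2 [B [t10 B0 SB]]]] := test_function_support _ th.
have [sm _ cS _] := th.
have cD := smooth_derive_continuous _ b sm.
have [K [cK KO UK]] := KU t1 t2 t10.
have cfK : {within K, continuous f}.
  by apply: continuous_in_subspaceT => W; rewrite inE => /KO; exact: cf.
have [C1 C10 fC1] := compact_norm_bound _ _ (continuous_compact cfK cK).
have D0 z : ~ closure [set z | theta z != 0] z -> 'D_(if b then dir1 else dir2) theta z = 0.
  exact: derive_off_support.
have [C2 C20 DC2] := continuous_bounded_off_compact _ _ _ (continuous_subspaceT cD) cS D0.
have mh := measurable_half_plane.
have mF : measurable_fun setT F.
  apply/(measurable_restrictT _ _).1 => //; apply: measurable_funM.
    apply: (@measurable_comp_continuous_on _ _ _ _ _ O f (fun z => U z.1 z.2)) => //.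
    move=> [t x] /= t0; have [K' [_ K'O UK']] := KU t t t0.
    by apply: K'O; apply: UK'; rewrite in_itv/= lexx.
  by apply: measurable_funTS; exact: measurable_continuous_plane.
pose a (t : R) := C1 * C2 * \1_(`[t1, t2]%classic : set R) t.
pose c (x : R) : R := \1_(`[- B, B]%classic : set R) x.
have iI (x y : R) : leb.-integrable setT (EFin \o (\1_(`[x, y]%classic : set R) : R -> R)).
  apply: (bounded_support_integrable _ (`|x| + `|y|) 1).
  - exact: measurable_indic.
  - by move=> z; rewrite indicE; case: (_ \in _); rewrite ?normr1 ?normr0.
  - move=> z xyz; rewrite indicE memNset// => /=; rewrite in_itv/= => /andP[xz zy].
    move: xyz; rewrite ltNge => /negP; apply; rewrite ler_norml; apply/andP; split.
      by rewrite (le_trans _ xz)// lerNl; have := ler_norm (- x); rewrite normrN; have := normr_ge0 y; lra.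
    by rewrite (le_trans zy)//; have := ler_norm y; have := normr_ge0 x; lra.
have ia : leb.-integrable setT (EFin \o a).
  have := integrableZl measurableT (C1 * C2) (iI t1 t2).
  by apply: eq_integrable.
have ic : leb.-integrable setT (EFin \o c) by exact: iI.
have Fac t x : `|F (t, x)| <= `|a t| * `|c x|.
  rewrite /F patchE; case: ifPn => [|_]; last by rewrite normr0 mulr_ge0.
  rewrite inE => htx /=.
  have [Stx|/D0 ->] := pselect (closure [set z | theta z != 0] (t, x)); last first.
    by rewrite mulr0 normr0 mulr_ge0.
  have [/= tt1 tt2 xB] := SB _ Stx.
  rewrite /a /c !indicE !mem_set/= ?in_itv/= ?tt1 ?tt2//; last by rewrite -ler_norml.
  rewrite !mulr1 normr1 mulr1 normrM (ger0_norm (mulr_ge0 (ltW C10) (ltW C20))).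
  apply: ler_pM => //; apply: fC1; exists (U t x) => //.
  by apply: UK; rewrite in_itv/= tt1.
split.
- exact: (product_integrable F a c).
- move=> t; apply: (@le_integrable _ _ _ leb _ _ _ (fun x => (a t)%:E * (c x)%:E)%E) => //.
  + by apply/measurable_EFinP; exact: measurable_fun_pair2.
  + by move=> x _; rewrite -EFinM lee_fin normrM; exact: Fac.
  + exact: integrableZl.
- move=> x; apply: (@le_integrable _ _ _ leb _ _ _ (fun t => (a t)%:E * (c x)%:E)%E) => //.
  + by apply/measurable_EFinP; exact: measurable_fun_pair1.
  + by move=> t _; rewrite -EFinM lee_fin normrM; exact: Fac.
  + exact: integrableZr.
Qed.

Lemma BV_field_state (U : R -> R -> 'rV[R]_n) t : BV_field O U -> 0 < t -> BV_state O (U t).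
Proof.
move=> [_ BVU KU] t0; split; first exact: BVU.
have [K [cK KO UK]] := KU t t t0.
by exists K; split=> // x; apply: UK; rewrite in_itv/= lexx.
Qed.

(** Existence excludes the dummy branch of [nonconservative_product]; uniqueness identifies the
    chosen measure with the derivative of [q o V]. *)
Lemma charge_integral_nonconservative phi (V : R -> 'rV[R]_n) (theta : R -> R) :
  lipschitz_paths O phi -> BV_state O V -> C1_compact_support theta ->
  charge_integral (nonconservative_product (fun W => grad eta W *m A W) phi V) setT theta =
  - \int[leb]_x (q (V x) * derive1 theta x).
Proof.
move=> lip BVV t1.
have [mu [ncp dmu uniq]] := nonconservative_product_exact n O q _ openO dq cdq compat phi V lip BVV.
rewrite -[RHS](dmu theta t1); apply: charge_integral_ext => //.
- move=> E mE; apply: uniq => //; rewrite /nonconservative_product.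
  case: pselect => [ex|]; last by case; exists mu.
  by case: cid.
- apply: continuous_measurable_fun => x.
  by apply/differentiable_continuous/derivable1_diffP; case: t1.
- by have [B [C [_ tC _ _ _]]] := C1_compact_supportP _ t1; exists C.
Qed.

(** The two left-hand sides are equal for each test function, by integrating the flux term over time
    slices; the equivalence follows. *)
Lemma entropy_inequality_equiv phi (U : R -> R -> 'rV[R]_n) :
  lipschitz_paths O phi -> BV_field O U ->
  nonconservative_entropy_inequality A eta phi U <->
  divergence_entropy_inequality eta q U.
Proof.
move=> lip BVU.
suff key theta : nonneg_test_function theta ->
    - (\int[(leb \x leb)%E]_(z in half_plane) (eta (U z.1 z.2) * 'D_dir1 theta z)) +
    \int[leb]_(t in `]0, +oo[)
       charge_integral (nonconservative_product (fun W => grad eta W *m A W) phi (U t))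
         setT (fun x => theta (t, x)) =
    - (\int[(leb \x leb)%E]_(z in half_plane)
         (eta (U z.1 z.2) * 'D_dir1 theta z + q (U z.1 z.2) * 'D_dir2 theta z)).
  by split=> H theta th; have := H theta th; rewrite key.
move=> th.
have cq W : O W -> {for W, continuous q}.
  by move=> OW; apply: differentiable_continuous; exact: dq.
have [iF1 _ _] := field_test_integrable eta U theta true ceta BVU th.
have [iF2 iF2t iF2x] := field_test_integrable q U theta false cq BVU th.
set F1 := (_ \_ half_plane) in iF1; set F2 := (_ \_ half_plane) in iF2 iF2t iF2x.
have [FubF2 _] := Rintegral_fubini F2 iF2 iF2t iF2x.
have -> : \int[(leb \x leb)%E]_(z in half_plane) (eta (U z.1 z.2) * 'D_dir1 theta z) =
    \int[(leb \x leb)%E]_z F1 z by rewrite Rintegral_mkcond.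
have -> : \int[(leb \x leb)%E]_(z in half_plane)
    (eta (U z.1 z.2) * 'D_dir1 theta z + q (U z.1 z.2) * 'D_dir2 theta z) =
    \int[(leb \x leb)%E]_z F1 z + \int[(leb \x leb)%E]_z F2 z.
  rewrite Rintegral_mkcond -RintegralD//; apply: eq_Rintegral => z _.
  by rewrite /F1 /F2 !patchE; case: ifP => _; rewrite ?addr0.
rewrite opprD; congr (_ + _); rewrite FubF2 Rintegral_mkcond.
have it : leb.-integrable setT (fun t => (\int[leb]_x F2 (t, x))%:E).
  have := integrable_fubini_F iF2; apply: eq_integrable => // t _.
  by rewrite /fubini_F fineK//; exact: integrable_fin_num.
rewrite -mulN1r -RintegralZl//; apply: eq_Rintegral => t _.
rewrite patchE; case: ifPn => [|].
  rewrite inE/= in_itv/= andbT => t0.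
  have [c1 dE] := slice_C1 _ t th.
  rewrite (charge_integral_nonconservative _ _ _ lip (BV_field_state _ _ BVU t0) c1) dE mulN1r.
  congr (- _); apply: eq_Rintegral => x _.
  by rewrite /F2 patchE ifT// inE.
rewrite notin_setE/= in_itv/= andbT => /negP t0.
rewrite (_ : (fun x => F2 (t, x)) = cst 0); first by rewrite Rintegral_cst// mul0r mulr0.
apply/funext => x; rewrite /F2 patchE ifN// notin_setE.
exact/negP.
Qed.

End InequalityEquivalence.

(** * The entropy pair of the nozzle equations *)

Section DifferentialRules.
Context {R : realType} {V : normedModType R}.

(** The differential is compared pointwise, so [df] may be any explicit formula, without a proof of
    linearity; its values at the vectors [delta_mx 0 j] are the entries of [grad]. *)
Definition has_diff (f : V -> R) (U : V) (df : V -> R) : Prop :=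
  differentiable f U /\ forall v, 'd f U v = df v.

Lemma has_diff_derive f U df v : has_diff f U df -> 'D_v f U = df v.
Proof. by move=> [df1 dfE]; rewrite deriveE. Qed.

Lemma has_diffM f g U df dg : has_diff f U df -> has_diff g U dg ->
  has_diff (fun W => f W * g W) U (fun v => f U * dg v + df v * g U).
Proof.
move=> [f1 fE] [g1 gE]; split; first exact: differentiableM.
move=> v; have -> : (fun W => f W * g W) = f * g by [].
rewrite diffM// -fE -gE.
by rewrite -[LHS]/(f U * 'd g U v + g U * 'd f U v) [g U * _]mulrC.
Qed.

Lemma has_diffB f g U df dg : has_diff f U df -> has_diff g U dg ->
  has_diff (fun W => f W - g W) U (fun v => df v - dg v).
Proof.
move=> [f1 fE] [g1 gE]; split; first exact: differentiableB.
move=> v; have -> : (fun W => f W - g W) = f - g by [].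
by rewrite diffB// -fE -gE.
Qed.

Lemma has_diff_comp1 (h : R -> R) f U df : has_diff f U df -> derivable h (f U) 1 ->
  has_diff (h \o f) U (fun v => derive1 h (f U) * df v).
Proof.
move=> [f1 fE] dh; have h1 : differentiable h (f U) by exact/derivable1_diffP.
split; first exact: differentiable_comp.
move=> v; transitivity ('d h (f U) ('d f U v)); first by rewrite diff_comp.
by rewrite -fE diff1E// /GRing.scale/= mulrC.
Qed.

Lemma has_diffV f U df : has_diff f U df -> f U != 0 ->
  has_diff (fun W => (f W)^-1) U (fun v => - df v / f U ^+ 2).
Proof.
move=> hf fU; have dinv : is_derive (f U) 1 (fun x : R => x^-1) (- (f U) ^- 2).
  have := @is_deriveV R id (f U) 1 1 fU (is_derive_id _ _).
  by rewrite /GRing.scale/= mulr1.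
have [+ _] := dinv => /(has_diff_comp1 _ _ _ _ hf) [d1 dE]; split => // v.
rewrite -[in LHS]/((fun x => x^-1) \o f) dE derive1E.
by rewrite (@derive_val _ _ _ _ _ _ _ dinv) mulrC mulNr mulrN.
Qed.

Lemma has_diff_comp2 (h : R * R -> R) f g U df dg :
  has_diff f U df -> has_diff g U dg -> differentiable h (f U, g U) ->
  has_diff (fun W => h (f W, g W)) U
    (fun v => 'D_dir1 h (f U, g U) * df v + 'D_dir2 h (f U, g U) * dg v).
Proof.
move=> [f1 fE] [g1 gE] h1.
have p1 : differentiable (fun W => (f W, g W)) U by exact: differentiable_pair.
split; first exact: (@differentiable_comp _ _ _ _ (fun W => (f W, g W)) h U p1 h1).
move=> v; rewrite (@diff_comp _ _ _ _ (fun W => (f W, g W)) h U p1 h1)/=.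
rewrite (@diff_pair _ _ _ _ f g U f1 g1)/= fE gE.
rewrite !deriveE//.
have -> : (df v, dg v) = df v *: dir1 + dg v *: dir2.
  by congr pair; rewrite /= /GRing.scale/= ?mulr1 ?mulr0 ?addr0 ?add0r.
rewrite linearD !linearZ; congr (_ + _); exact: mulrC.
Qed.

End DifferentialRules.

Lemma has_diff_coord {R : realType} n (U : 'rV[R]_n) (j : 'I_n) :
  has_diff (fun W : 'rV[R]_n => W 0 j) U (fun v => v 0 j).
Proof.
pose f (W : 'rV[R]_n) : R := W 0 j.
have lin : linear f by move=> a u v; rewrite /f !mxE.
pose fM := GRing.isLinear.Build _ _ _ _ _ lin.
pose fL : {linear _ -> _} := HB.pack f fM.
have cf : continuous fL by exact: coord_continuous.
split; first exact: (@linear_differentiable _ _ _ fL).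
by move=> v; rewrite -[fun W => _]/(fL : _ -> _) (@diff_lin _ _ _ fL).
Qed.

Section NozzleDerivatives.
Context {R : realType} (D : set (R * R)) (p S T : R * R -> R) (g : R -> R).
Hypothesis eos : equations_of_state D p S T.
Hypothesis g_diff : forall s, (S @` density_domain D) s ->
  derivable g s 1 /\ derivable (derive1 g) s 1.
Implicit Types U v : 'rV[R]_4.

Local Notation O := (nozzle_states D).

Lemma nozzle_area_gt0 U : O U -> 0 < U 0 3%:R.
Proof. by case. Qed.

Lemma nozzle_mass_gt0 U : O U -> 0 < U 0 0.
Proof.
by move=> [a0 [/= r0 _]]; have := mulr_gt0 r0 a0; rewrite /density mulfVK// gt_eqF.
Qed.

(** The differential of a quotient, kept in the unsimplified shape that [has_diffM] and [has_diffV]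
    produce, so that those rules apply by conversion. *)
Definition ddensity U v : R := U 0 0 * (- v 0 3%:R / U 0 3%:R ^+ 2) + v 0 0 * (U 0 3%:R)^-1.
Definition dvelocity U v : R := U 0 1%:R * (- v 0 0 / U 0 0 ^+ 2) + v 0 1%:R * (U 0 0)^-1.
Definition dtotal_energy U v : R := U 0 2%:R * (- v 0 0 / U 0 0 ^+ 2) + v 0 2%:R * (U 0 0)^-1.
Definition dinternal_energy U v : R := dtotal_energy U v - velocity U * dvelocity U v.
Definition dspecific_entropy U v : R := derive1 g (S (thermo U)) *
  ('D_dir1 S (thermo U) * ddensity U v + 'D_dir2 S (thermo U) * dinternal_energy U v).
Definition dnozzle_entropy U v : R :=
  area U * density U * dspecific_entropy U v +
  (area U * ddensity U v + v 0 3%:R * density U) * g (S (thermo U)).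
Definition dnozzle_entropy_flux U v : R :=
  area U * density U * velocity U * dspecific_entropy U v +
  (area U * density U * dvelocity U v +
   (area U * ddensity U v + v 0 3%:R * density U) * velocity U) * g (S (thermo U)).

Lemma has_diff_density U : O U -> has_diff density U (ddensity U).
Proof.
move=> OU; have := has_diffM _ _ _ _ _ (has_diff_coord _ U 0)
  (has_diffV _ _ _ (has_diff_coord _ U 3%:R) _).
by apply; rewrite gt_eqF ?nozzle_area_gt0.
Qed.

Lemma has_diff_velocity U : O U -> has_diff velocity U (dvelocity U).
Proof.
move=> OU; have := has_diffM _ _ _ _ _ (has_diff_coord _ U 1%:R)
  (has_diffV _ _ _ (has_diff_coord _ U 0) _).
by apply; rewrite gt_eqF ?nozzle_mass_gt0.
Qed.

Lemma has_diff_internal_energy U : O U -> has_diff internal_energy U (dinternal_energy U).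
Proof.
move=> OU; have he : has_diff total_energy U (dtotal_energy U).
  have := has_diffM _ _ _ _ _ (has_diff_coord _ U 2%:R)
    (has_diffV _ _ _ (has_diff_coord _ U 0) _).
  by apply; rewrite gt_eqF ?nozzle_mass_gt0.
pose h (x : R) : R := x ^+ 2 / 2.
have dh (x : R) : is_derive x 1 h x.
  by rewrite /h; apply: is_derive_eq; rewrite /GRing.scale/=; field.
have hu : has_diff (h \o velocity) U (fun v => velocity U * dvelocity U v).
  have dhu : derivable h (velocity U) 1 by case: (dh (velocity U)).
  have [d1 d2] := has_diff_comp1 h _ _ _ (has_diff_velocity _ OU) dhu.
  split=> // v; rewrite d2 derive1E; congr (_ * _).
  exact: (@derive_val _ _ _ _ _ _ _ (dh _)).
exact: has_diffB he hu.
Qed.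

Lemma has_diff_entropy U : O U -> has_diff (g \o S \o thermo) U (dspecific_entropy U).
Proof.
move=> OU; have [a0 dom] := OU.
have hS : has_diff (fun W => S (density W, internal_energy W)) U
    (fun v => 'D_dir1 S (thermo U) * ddensity U v + 'D_dir2 S (thermo U) * dinternal_energy U v).
  apply: has_diff_comp2; [exact: has_diff_density|exact: has_diff_internal_energy|].
  exact: (eos_smooth_S eos [::] dom).
apply: (has_diff_comp1 g _ _ _ hS).
by case: (g_diff (S (thermo U)) (ex_intro2 _ _ (thermo U) dom (erefl (S (thermo U))))).
Qed.

Lemma has_diff_nozzle_entropy U : O U ->
  has_diff (nozzle_entropy S g) U (dnozzle_entropy U).
Proof.
move=> OU.
exact: has_diffM (has_diffM _ _ _ _ _ (has_diff_coord _ U 3%:R) (has_diff_density _ OU))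
  (has_diff_entropy _ OU).
Qed.

Lemma has_diff_nozzle_entropy_flux U : O U ->
  has_diff (nozzle_entropy_flux S g) U (dnozzle_entropy_flux U).
Proof.
move=> OU.
exact: has_diffM (has_diffM _ _ _ _ _
  (has_diffM _ _ _ _ _ (has_diff_coord _ U 3%:R) (has_diff_density _ OU))
  (has_diff_velocity _ OU)) (has_diff_entropy _ OU).
Qed.

Lemma sum_ord4 (F : 'I_4 -> R) :
  \sum_i F i = F 0 + F 1%:R + F 2%:R + F 3%:R.
Proof.
rewrite !big_ord_recl big_ord0 addr0 !addrA.
by congr (_ + _ + _ + _); congr F; apply/val_inj.
Qed.

(** After [S1] and [S2] replace the derivatives of [S], the numbers [p], its two partial
    derivatives, [T], [g] and its derivative can be treated as independent variables: each column is
    an identity of rational functions in them and the coordinates of [U]. *)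
Lemma nozzle_compatible U : O U ->
  grad (nozzle_entropy S g) U *m nozzle_matrix p U = grad (nozzle_entropy_flux S g) U.
Proof.
move=> OU; have a0 := nozzle_area_gt0 _ OU; have m0 := nozzle_mass_gt0 _ OU.
have [_ dom] := OU.
have T0 := eos_T_gt0 eos dom.
have S1 := eos_S_rho eos dom; have S2 := eos_S_eps eos dom.
have gradE j : grad (nozzle_entropy S g) U 0 j = dnozzle_entropy U (delta_mx 0 j).
  by rewrite mxE; apply: has_diff_derive; exact: has_diff_nozzle_entropy.
have gradqE j : grad (nozzle_entropy_flux S g) U 0 j = dnozzle_entropy_flux U (delta_mx 0 j).
  by rewrite mxE; apply: has_diff_derive; exact: has_diff_nozzle_entropy_flux.
apply/rowP => j; rewrite mxE sum_ord4 gradqE !gradE.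
rewrite /dnozzle_entropy /dnozzle_entropy_flux /dspecific_entropy S1 S2.
rewrite /dinternal_energy /ddensity /dvelocity /dtotal_energy.
have rE : (thermo U).1 = U 0 0 / U 0 3%:R by [].
rewrite rE !mxE /velocity /total_energy /density /area.
move: (p (thermo U)) ('D_dir1 p (thermo U)) ('D_dir2 p (thermo U)) (T (thermo U)) T0
  (g (S (thermo U))) (derive1 g (S (thermo U))) => P p1 p2 t t0 G G'.
move: (U 0 0) (U 0 1%:R) (U 0 2%:R) (U 0 3%:R) m0 a0 => m k E a m0 a0.
rewrite -!val_eqE /=.
have {a0 m0 t0} [a0 m0 t0] : [/\ a != 0, m != 0 & t != 0] by rewrite !gt_eqF.
have [|[|[|]]] : j = 0%N :> nat \/ j = 1%N :> nat \/ j = 2%N :> nat \/ j = 3%N :> nat.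
  by case: j => [[|[|[|[|//]]]] jlt] /=; tauto.
all: move=> -> /=.
all: rewrite ?mulr0n ?mulr1n; field; rewrite ?a0 ?m0 ?t0 //.
Qed.

End NozzleDerivatives.

Lemma derivable_continuous {R : realType} (h : R -> R) x :
  derivable h x 1 -> {for x, continuous h}.
Proof. by move=> dh; apply: differentiable_continuous; exact/derivable1_diffP. Qed.

(** * Openness of the state space and regularity of the flux *)

Section NozzleRegularity.
Context {R : realType} (D : set (R * R)) (p S T : R * R -> R) (g : R -> R).
Hypothesis eos : equations_of_state D p S T.
Hypothesis g_diff : forall s, (S @` density_domain D) s ->
  derivable g s 1 /\ derivable (derive1 g) s 1.
Implicit Types U v : 'rV[R]_4.

Local Notation O := (nozzle_states D).

Lemma density_continuous U : O U -> {for U, continuous (@density R)}.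
Proof. by move=> OU; apply: differentiable_continuous; case: (has_diff_density _ _ OU). Qed.

Lemma velocity_continuous U : O U -> {for U, continuous (@velocity R)}.
Proof. by move=> OU; apply: differentiable_continuous; case: (has_diff_velocity _ _ OU). Qed.

Lemma internal_energy_continuous U : O U -> {for U, continuous (@internal_energy R)}.
Proof.
by move=> OU; apply: differentiable_continuous; case: (has_diff_internal_energy _ _ OU).
Qed.

Lemma thermo_continuous U : O U -> {for U, continuous (@thermo R)}.
Proof.
move=> OU; exact: cvg_pair (density_continuous _ OU) (internal_energy_continuous _ OU).
Qed.

Lemma nozzle_states_open : open O.
Proof.
rewrite openE => U OU; have [a0 [/= r0 dU]] := OU.
have ca : (@area R) @ U --> area U by exact: coord_continuous.
have cr := density_continuous _ OU.
have cv : (fun W => ((density W)^-1, internal_energy W)) @ U --> ((density U)^-1, internal_energy U).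
  have cri : (fun W => (density W)^-1) @ U --> (density U)^-1 
    by apply: (cvgV (lt0r_neq0 r0) cr).
  exact: cvg_pair cri (internal_energy_continuous _ OU).
have nD : nbhs ((density U)^-1, internal_energy U) D.
  by apply: open_nbhs_nbhs; split => //; exact: (eos_open eos).
apply: filterS3 (cvgr_gt _ ca _ a0) (cvgr_gt _ cr _ r0) (cv _ nD) => W aW rW dW.
by split=> //; split.
Qed.

(** The second derivative of [g] enters here, through the continuity of [derive1 g]. *)
Lemma grad_nozzle_entropy_flux_continuous U j : O U ->
  {for U, continuous (fun W => grad (nozzle_entropy_flux S g) W 0 j)}.
Proof.
move=> OU; pose v : 'rV[R]_4 := delta_mx 0 j.
have E W : O W -> grad (nozzle_entropy_flux S g) W 0 j = dnozzle_entropy_flux S g W v.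
  by move=> OW; rewrite mxE; apply: has_diff_derive;
     exact: (has_diff_nozzle_entropy_flux _ _ _ _ _ eos).
rewrite /prop_for /continuous_at E//.
(* The explicit formula for the gradient holds on states only; since they form an open set, it can
   replace the gradient near [U]. *)
apply: (@cvg_trans _ (dnozzle_entropy_flux S g ^~ v @ U)).
  have := nozzle_states_open; rewrite openE => /(_ _ OU) OnU.
  apply: (@near_eq_cvg _ _ (nbhs U) _ (dnozzle_entropy_flux S g ^~ v)
    (fun W => grad (nozzle_entropy_flux S g) W 0 j)).
  by apply: filterS OnU => W OW; rewrite E.
have cc k : (fun W : 'rV[R]_4 => W 0 k) @ U --> U 0 k by exact: coord_continuous.
have ci k : U 0 k != 0 -> (fun W : 'rV[R]_4 => (W 0 k)^-1) @ U --> (U 0 k)^-1.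
  by move=> Uk; exact: (cvgV Uk (cc k)).
have ci2 k : U 0 k != 0 -> (fun W : 'rV[R]_4 => (W 0 k ^+ 2)^-1) @ U --> (U 0 k ^+ 2)^-1.
  move=> Uk; have cc2 : (fun W : 'rV[R]_4 => W 0 k ^+ 2) @ U --> U 0 k ^+ 2.
    under eq_fun do rewrite expr2.
    by rewrite expr2; exact: cvgM (cc k) (cc k).
  exact: (cvgV (expf_neq0 2 Uk) cc2).
have k0 (x : R) : (fun _ : 'rV[R]_4 => x) @ U --> x by apply: cst_continuous.
have a0 : U 0 3%:R != 0 by rewrite gt_eqF// (nozzle_area_gt0 _ _ OU).
have m0 : U 0 0 != 0 by rewrite gt_eqF// (nozzle_mass_gt0 _ _ OU).
have cdr : ddensity ^~ v @ U --> ddensity U v.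
  exact: cvgD (cvgM (cc _) (cvgM (k0 _) (ci2 _ a0))) (cvgM (k0 _) (ci _ a0)).
have cdu : dvelocity ^~ v @ U --> dvelocity U v.
  exact: cvgD (cvgM (cc _) (cvgM (k0 _) (ci2 _ m0))) (cvgM (k0 _) (ci _ m0)).
have cde : dtotal_energy ^~ v @ U --> dtotal_energy U v.
  exact: cvgD (cvgM (cc _) (cvgM (k0 _) (ci2 _ m0))) (cvgM (k0 _) (ci _ m0)).
have cr := density_continuous _ OU.
have cu := velocity_continuous _ OU.
have cth := thermo_continuous _ OU.
have cdi : dinternal_energy ^~ v @ U --> dinternal_energy U v.
  exact: cvgB cde (cvgM cu cdu).
have [_ dom] := OU.
have cS1 : ('D_dir1 S \o (@thermo R)) @ U --> 'D_dir1 S (thermo U).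
  have c : {for thermo U, continuous ('D_dir1 S)}.
    by apply: differentiable_continuous; exact: (eos_smooth_S eos [:: true] dom).
  exact: (@cvg_comp _ _ _ (@thermo R) ('D_dir1 S) _ _ _ cth c).
have cS2 : ('D_dir2 S \o (@thermo R)) @ U --> 'D_dir2 S (thermo U).
  have c : {for thermo U, continuous ('D_dir2 S)}.
    by apply: differentiable_continuous; exact: (eos_smooth_S eos [:: false] dom).
  exact: (@cvg_comp _ _ _ (@thermo R) ('D_dir2 S) _ _ _ cth c).
have cS : (S \o (@thermo R)) @ U --> S (thermo U).
  have c : {for thermo U, continuous S}.
    by apply: differentiable_continuous; exact: (eos_smooth_S eos [::] dom).
  exact: (@cvg_comp _ _ _ (@thermo R) S _ _ _ cth c).
have [dg dg'] := g_diff (S (thermo U)) (ex_intro2 _ _ (thermo U) dom (erefl (S (thermo U)))).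
have cg1 : (derive1 g \o (S \o (@thermo R))) @ U --> derive1 g (S (thermo U)).
  have c : {for S (thermo U), continuous (derive1 g)}.
    exact: derivable_continuous dg'.
  exact: (@cvg_comp _ _ _ (S \o @thermo R) (derive1 g) _ _ _ cS c).
have cg : (g \o (S \o (@thermo R))) @ U --> g (S (thermo U)).
  have c : {for S (thermo U), continuous g}.
    exact: derivable_continuous dg.
  exact: (@cvg_comp _ _ _ (S \o @thermo R) g _ _ _ cS c).
have cds : dspecific_entropy S g ^~ v @ U --> dspecific_entropy S g U v.
  exact: cvgM cg1 (cvgD (cvgM cS1 cdr) (cvgM cS2 cdi)).
have ca : (@area R) @ U --> area U by exact: coord_continuous.
exact: cvgD (cvgM (cvgM (cvgM ca cr) cu) cds)
  (cvgM (cvgD (cvgM (cvgM ca cr) cdu) (cvgM (cvgD (cvgM ca cdr) (cvgM (k0 _) cr)) cu)) cg).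
Qed.

End NozzleRegularity.

(** * Convexity of the entropy *)

Section NozzleConvexity.
Context {R : realType} (D : set (R * R)) (p S T : R * R -> R) (g : R -> R).
Hypothesis eos : equations_of_state D p S T.
Hypothesis g_decreasing : forall s1 s2,
  (S @` density_domain D) s1 -> (S @` density_domain D) s2 -> s1 < s2 -> g s2 < g s1.
Hypothesis g_convex : strictly_convex_on D (g \o of_volume S).

Local Notation O := (nozzle_states D).

Lemma domain_convex (x y : R * R) (t : R) : D x -> D y -> 0 <= t -> t <= 1 ->
  D (t *: x + (1 - t) *: y).
Proof.
move=> Dx Dy t0 t1; have t01 : Itv.spec (@Itv.num_sem R) (Itv.Real `[0%Z, 1%Z]) t.
  by rewrite /Itv.spec/=/Itv.num_sem/= num_real/= in_itv/= t0 t1.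
have cD : convex_set D := eos_convex eos.
have := cD x y (Itv.Def t01).
by rewrite !inE; apply.
Qed.

(** Convexity of [D] keeps the segment at constant volume inside the domain, where the mean value
    theorem meets the positive derivative [1 / T]. *)
Lemma entropy_increasing (v e1 e2 : R) : D (v, e1) -> D (v, e2) -> e1 < e2 ->
  of_volume S (v, e1) < of_volume S (v, e2).
Proof.
move=> D1 D2 e12; have v0 := eos_volume_gt0 eos D1.
have De e : e \in `[e1, e2] -> density_domain D (v^-1, e).
  rewrite in_itv/= => /andP[h1 h2]; split; first by rewrite /= invr_gt0.
  rewrite /= invrK; pose t := (e2 - e) / (e2 - e1).
  have e21 : e2 - e1 != 0 by rewrite gt_eqF// subr_gt0.
  have -> : (v, e) = t *: (v, e1) + (1 - t) *: (v, e2).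
    by congr pair; rewrite /= /GRing.scale/= /t; field.
  apply: domain_convex => //; rewrite /t; first by rewrite divr_ge0// subr_ge0 ?(ltW e12).
  by rewrite ler_pdivrMr ?subr_gt0// mul1r lerD2l lerN2.
pose f (e : R) : R := S (v^-1, e); pose df (e : R) : R := 'D_dir2 S (v^-1, e).
have dS (e : R) : e \in `[e1, e2] -> is_derive e 1 f (df e).
  by move=> he; apply: is_derive_slice; exact: (eos_smooth_S eos [::] (De _ he)).
have dfo (e : R) : e \in `]e1, e2[ -> is_derive e 1 f (df e).
  by move=> he; apply: dS; exact: subset_itv_oo_cc he.
have cf : {within `[e1, e2], continuous f}.
  by apply: derivable_within_continuous => e he; case: (dS e he).
have [c ce E] := @MVT R f df e1 e2 e12 dfo cf.
have dc := De _ (subset_itv_oo_cc ce).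
rewrite -subr_gt0 -[_ - _]/(f e2 - f e1) E /df (eos_S_eps eos dc) mulr_gt0 ?subr_gt0//.
by rewrite invr_gt0 (eos_T_gt0 eos dc).
Qed.

Lemma entropy_function_nonincreasing (v e1 e2 : R) : D (v, e1) -> D (v, e2) -> e1 <= e2 ->
  g (of_volume S (v, e2)) <= g (of_volume S (v, e1)).
Proof.
move=> D1 D2; rewrite le_eqVlt => /predU1P[->//|e12]; apply: ltW.
have im e : D (v, e) -> (S @` density_domain D) (of_volume S (v, e)).
  move=> De; exists (v^-1, e) => //; split; rewrite /= ?invrK//.
  by rewrite invr_gt0 (eos_volume_gt0 eos De).
by apply: g_decreasing; [exact: im|exact: im|exact: entropy_increasing].
Qed.

Lemma nozzle_stateE (U : 'rV[R]_4) : O U ->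
  let w := (U 0 3%:R / U 0 0, U 0 2%:R / U 0 0 - (U 0 1%:R / U 0 0) ^+ 2 / 2) in
  D w /\ nozzle_entropy S g U = U 0 0 * g (of_volume S w).
Proof.
move=> OU; have a0 := nozzle_area_gt0 _ _ OU; have m0 := nozzle_mass_gt0 _ _ OU.
have [_ [_ Dw]] := OU; move: Dw; rewrite /thermo/= /density invf_div => Dw.
split=> //.
rewrite /nozzle_entropy /of_volume /thermo /density /area /= invf_div.
by rewrite [U 0 3%:R * _]mulrC (divfK (lt0r_neq0 a0)).
Qed.

(* [U0 h (U3 / U0, U2 / U0 - (U1 / U0)^2 / 2)] is the perspective of a convex
   function of (v, u, e), as [h] is convex and nonincreasing in its second
   argument while [e - u^2 / 2] is concave. *)
Lemma nozzle_entropy_convex : convex_on O (nozzle_entropy S g).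
Proof.
move=> C convC CO t X Y CX CY; rewrite /= in X Y CX CY *.
have CZ := convC _ _ t CX CY.
have OX : O X by apply: CO; rewrite -inE.
have OY : O Y by apply: CO; rewrite -inE.
have OZ : O (t%:num *: X + (1 - t%:num) *: Y) by apply: CO; rewrite -inE.
rewrite -[leLHS]/(nozzle_entropy S g (t%:num *: X + (1 - t%:num) *: Y)).
rewrite -[leRHS]/(t%:num * nozzle_entropy S g X + (1 - t%:num) * nozzle_entropy S g Y).
have t0 : 0 <= t%:num by []. have t1 : t%:num <= 1 by [].
move: (t%:num) t0 t1 OZ => {CX CY CZ}s s0 s1 OZ.
have X0 := nozzle_mass_gt0 _ _ OX; have Y0 := nozzle_mass_gt0 _ _ OY.
have Z0 := nozzle_mass_gt0 _ _ OZ.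
have [DX ->] := nozzle_stateE _ OX; have [DY ->] := nozzle_stateE _ OY.
have [DZ ->] := nozzle_stateE _ OZ.
move: Z0 DZ; rewrite !mxE.
move: (X 0 0) (X 0 1%:R) (X 0 2%:R) (X 0 3%:R) (Y 0 0) (Y 0 1%:R) (Y 0 2%:R) (Y 0 3%:R)
  X0 Y0 DX DY => mX kX EX aX mY kY EY aY mX0 mY0 DX DY mZ0 DZ.
set mZ := s * mX + (1 - s) * mY in mZ0 DZ *.
(* [l] is the share of [X] in the mixed mass: volumes, velocities and total energies per unit mass
   average with weights [l] and [1 - l]. *)
pose l := s * mX / mZ.
have l0 : 0 <= l by rewrite divr_ge0 ?mulr_ge0 ?(ltW mX0) ?(ltW mZ0).
have sY : 0 <= (1 - s) * mY by rewrite mulr_ge0 ?subr_ge0 ?(ltW mY0).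
have l1 : l <= 1 by rewrite ler_pdivrMr// mul1r lerDl.
have lE : mZ * l = s * mX by rewrite mulrC divfK ?gt_eqF.
have l'E : mZ * (1 - l) = (1 - s) * mY by rewrite mulrBr lE mulr1 /mZ addrC addKr.
set wX := (aX / mX, _) in DX *; set wY := (aY / mY, _) in DY *; set wZ := (_ / mZ, _) in DZ *.
have Dl : D (l *: wX + (1 - l) *: wY) by exact: domain_convex.
have convh : g (of_volume S (l *: wX + (1 - l) *: wY)) <=
    l * g (of_volume S wX) + (1 - l) * g (of_volume S wY).
  (* Strict convexity speaks of distinct points and interior weights, so the degenerate cases are
     settled separately. *)
  have [->|] := eqVneq l 0; first by rewrite scale0r subr0 scale1r add0r mul0r mul1r add0r.
  have [->|] := eqVneq l 1; first by rewrite subrr scale1r scale0r addr0 mul0r mul1r addr0.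
  move=> ln1 ln0.
  have [<-|/eqP XY] := eqVneq wX wY.
    by rewrite -scalerDl -mulrDl addrC subrK scale1r mul1r.
  apply: ltW; apply: (g_convex wX wY l DX DY XY).
  by rewrite !lt_neqAle l0 l1 ln1 eq_sym ln0.
suff E : g (of_volume S wZ) <= g (of_volume S (l *: wX + (1 - l) *: wY)).
  have := le_trans E convh; rewrite -(ler_pM2l mZ0) => /le_trans; apply.
  by rewrite [leLHS]mulrDr (mulrA mZ l) lE (mulrA mZ (1 - l)) l'E !mulrA.
have mX1 : mX != 0 by rewrite gt_eqF.
have mY1 : mY != 0 by rewrite gt_eqF.
have mZ1 : s * mX + (1 - s) * mY != 0 by rewrite -/mZ gt_eqF.
have v1 : (l *: wX + (1 - l) *: wY).1 = wZ.1.
  by rewrite /= /GRing.scale/= /l /mZ; field; rewrite mX1 mY1 mZ1.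
have e1 : (l *: wX + (1 - l) *: wY).2 <= wZ.2.
  rewrite -subr_ge0 /= /GRing.scale/=.
  (* Averaging the velocity loses kinetic energy: the internal energy gained is half the variance of
     the velocity under the weights [l] and [1 - l]. *)
  have -> : (s * EX + (1 - s) * EY) / mZ - ((s * kX + (1 - s) * kY) / mZ) ^+ 2 / 2 -
      (l * (EX / mX - (kX / mX) ^+ 2 / 2) + (1 - l) * (EY / mY - (kY / mY) ^+ 2 / 2)) =
      l * (1 - l) * (kX / mX - kY / mY) ^+ 2 / 2.
    by rewrite /l /mZ; field; rewrite mX1 mY1 mZ1.
  by rewrite divr_ge0// mulr_ge0 ?sqr_ge0// mulr_ge0// subr_ge0.
move: v1 e1 Dl DZ; case: (l *: wX + (1 - l) *: wY) => v e /= -> e1 Dl DZ.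
by apply: entropy_function_nonincreasing.
Qed.

End NozzleConvexity.

Theorem proposition3p1 (R : realType) (D : set (R * R)) (p S T : R * R -> R)
    (eos : equations_of_state D p S T)
    (g : R -> R)
    (g_twice_differentiable : forall s, (S @` density_domain D) s ->
       derivable g s 1 /\ derivable (derive1 g) s 1)
    (g_decreasing : forall s1 s2,
       (S @` density_domain D) s1 -> (S @` density_domain D) s2 ->
       s1 < s2 -> g s2 < g s1)
    (g_convex : strictly_convex_on D (g \o of_volume S)) :
  entropy_pair (nozzle_states D) (nozzle_matrix p)
    (nozzle_entropy S g) (nozzle_entropy_flux S g) /\
  forall phi : R -> 'rV[R]_4 -> 'rV[R]_4 -> 'rV[R]_4,
    lipschitz_paths (nozzle_states D) phi ->
    (forall V : R -> 'rV[R]_4, BV_state (nozzle_states D) V ->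
       exists2 mu : {charge set (measurableTypeR R) -> \bar R},
         is_nonconservative_product
           (fun U => grad (nozzle_entropy S g) U *m nozzle_matrix p U) phi V mu &
         forall mu' : {charge set (measurableTypeR R) -> \bar R},
           is_nonconservative_product
             (fun U => grad (nozzle_entropy S g) U *m nozzle_matrix p U) phi V mu' ->
           forall E : set R, measurable E -> mu' E = mu E) /\
    (forall U : R -> R -> 'rV[R]_4, BV_field (nozzle_states D) U ->
       nonconservative_entropy_inequality (nozzle_matrix p)
         (nozzle_entropy S g) phi U <->
       divergence_entropy_inequality
         (nozzle_entropy S g) (nozzle_entropy_flux S g) U).
Proof.
have openO := nozzle_states_open _ _ _ _ eos.
have deta U : nozzle_states D U -> differentiable (nozzle_entropy S g) U.
  by move=> OU; case: (has_diff_nozzle_entropy _ _ _ _ _ eos g_twice_differentiable _ OU).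
have dq U : nozzle_states D U -> differentiable (nozzle_entropy_flux S g) U.
  by move=> OU; case: (has_diff_nozzle_entropy_flux _ _ _ _ _ eos g_twice_differentiable _ OU).
have compat U : nozzle_states D U ->
    grad (nozzle_entropy S g) U *m nozzle_matrix p U = grad (nozzle_entropy_flux S g) U.
  exact: nozzle_compatible eos g_twice_differentiable U.
have ceta U : nozzle_states D U -> {for U, continuous (nozzle_entropy S g)}.
  by move=> OU; apply: differentiable_continuous; exact: deta.
have cdq U i : nozzle_states D U ->
    {for U, continuous (fun W => grad (nozzle_entropy_flux S g) W 0 i)}.
  exact: grad_nozzle_entropy_flux_continuous eos g_twice_differentiable U i.
split.
  by split=> //; exact: nozzle_entropy_convex eos g_decreasing g_convex.
move=> phi lip; split=> [V BVV|U BVU].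
  have [mu [ncp _ uniq]] :=
    nonconservative_product_exact _ _ _ _ openO dq cdq compat phi V lip BVV.
  by exists mu.
exact: entropy_inequality_equiv openO ceta dq cdq compat phi U lip BVU.
Qed.
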